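(* Let $Q$ be a Dynkin quiver with vertices $1,\dots,n$, $k$ a source of $Q$, $\mathbf d$ a dimension vector and ${\boldsymbol\nu}=(\nu^i)$ with $\nu^i\vdash d_i$. Let $\lambda=\nu^k$ and $\mu=\nu^{\mathrm{adj}(k)}$ and suppose $\lambda$ and $\mu$ are $t$-interlaced for some $t\ge0$. Let $V\simeq\operatorname{GenRep}({\boldsymbol\nu})$. Then $R^-_k(V)\simeq\operatorname{GenRep}(\sigma_k({\boldsymbol\nu}))$.
   Context: $\Bbbk$ algebraically closed; Dynkin quiver: underlying graph a simply-laced Dynkin diagram. For ${\boldsymbol\nu}\vdash\mathbf d$ and a quiver $\Gamma$ of Dynkin type, fix nilpotent operators $N_i$ on spaces of dimension $d_i$ with Jordan types $\nu^i$; among the representations of $\Gamma$ on these spaces compatible with $N$ ($N_{t(a)}f_a=f_aN_{s(a)}$ for all arrows), there is a dense open subset of pairwise isomorphic representations; $\operatorname{GenRep}({\boldsymbol\nu})$ denotes this isomorphism class. $R^-_k$ is the BGP reflection functor at the source $k$: $R^-_k(V)$ is the representation of $\sigma_k(Q)$ (arrows at $k$ reversed) with $R^-_k(V)_i=V_i$ for $i\neq k$, $R^-_k(V)_k=\operatorname{coker}(V_k\to\bigoplus_{a:k\to t(a)}V_{t(a)})$, and reversed maps the inclusions followed by the projection. $\nu^{\mathrm{adj}(k)}$: partition whose parts are the union over arrows $a:k\to t(a)$ of the parts of $\nu^{t(a)}$. Padding partitions with zeros, for $t\ge0$, $\lambda,\mu$ are $t$-interlaced if $\mu_1\ge\dots\ge\mu_{t+1}\ge\lambda_1\ge\mu_{t+2}\ge\mu_{t+3}\ge\lambda_2\ge\mu_{t+4}\ge\mu_{t+5}\ge\lambda_3\ge\cdots$,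 and then $\operatorname{diff}(\mu,\lambda)=(\mu_1,\dots,\mu_t,\mu_{t+1}+\mu_{t+2}-\lambda_1,\mu_{t+3}+\mu_{t+4}-\lambda_2,\dots)$ (independent of the choice of such $t$). $\sigma_k({\boldsymbol\nu})$ equals ${\boldsymbol\nu}$ except that $\nu^k$ is replaced by $\operatorname{diff}(\nu^{\mathrm{adj}(k)},\nu^k)$. *)

(* Defs.v *)
From mathcomp Require Import all_boot all_order all_algebra all_fingroup.
Set Implicit Arguments. Unset Strict Implicit. Unset Printing Implicit Defensive.
Import GRing.Theory.
Local Open Scope ring_scope.
Import Order.TTheory.

Definition is_part (l : seq nat) : bool := sorted geq l && all (leq 1) l.

Inductive dynkin_type := TA | TD | TE.

Definition chainE (m i j : nat) : bool :=
  [&& (i.+1 == j) || (j.+1 == i), (i < m)%N & (j < m)%N].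
Definition pairE (x y i j : nat) : bool :=
  ((i == x) && (j == y)) || ((i == y) && (j == x)).

Definition dynkin_valid (ty : dynkin_type) (n : nat) : bool :=
  match ty with
  | TA => 1 <= n
  | TD => 4 <= n
  | TE => (6 <= n) && (n <= 8)
  end%N.

Definition dynkin_edge (ty : dynkin_type) (n i j : nat) : bool :=
  match ty with
  | TA => chainE n i j
  | TD => chainE n.-1 i j || pairE (n - 3) n.-1 i j
  | TE => chainE n.-1 i j || pairE 2 n.-1 i j
  end.

Section Quiver.
Variables (n : nat) (A : finType) (src tgt : A -> 'I_n).

(* The underlying (multi)graph of the quiver is a simply-laced Dynkin diagram:
   up to relabelling the vertices by a permutation p, the number of arrows
   between i and j (in either direction; loops when i = j) is 1 if {i,j} is
   an edge of the diagram and 0 otherwise. *)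
Definition is_dynkin_quiver : Prop :=
  exists (ty : dynkin_type) (p : {perm 'I_n}),
    dynkin_valid ty n /\
    forall i j : 'I_n,
      #|[pred a | ((src a == i) && (tgt a == j)) || ((src a == j) && (tgt a == i))]|
      = nat_of_bool (dynkin_edge ty n (p i) (p j)).

Definition is_source (k : 'I_n) : Prop := forall a, tgt a != k.

Definition adj_part (k : 'I_n) (nu : 'I_n -> seq nat) : seq nat :=
  sort geq (flatten [seq nu (tgt a) | a <- enum A & src a == k]).

Variable K : fieldType.

(* representations with dimension vector d; f_a : K^{d (src a)} -> K^{d (tgt a)}
   acting on column vectors *)
Definition repT (d : 'I_n -> nat) := forall a : A, 'M[K]_(d (tgt a), d (src a)).

Definition rep_iso (d1 d2 : 'I_n -> nat) (X : repT d1) (Y : repT d2) : Prop :=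
  exists (phi : forall i, 'M[K]_(d2 i, d1 i)) (psi : forall i, 'M[K]_(d1 i, d2 i)),
    (forall i, psi i *m phi i = 1%:M /\ phi i *m psi i = 1%:M) /\
    (forall a, phi (tgt a) *m X a = Y a *m phi (src a)).

Inductive polyfun (d : 'I_n -> nat) : (repT d -> K) -> Prop :=
  | pf_const (c : K) : polyfun (fun _ => c)
  | pf_coord (a : A) (i : 'I_(d (tgt a))) (j : 'I_(d (src a))) :
      polyfun (fun X => X a i j)
  | pf_add f g : polyfun f -> polyfun g -> polyfun (fun X => f X + g X)
  | pf_mul f g : polyfun f -> polyfun g -> polyfun (fun X => f X * g X).

Definition vanish (d : 'I_n -> nat) (S : (repT d -> K) -> Prop) (X : repT d) : Prop :=
  forall f, S f -> f X = 0.

Definition rel_open (d : 'I_n -> nat) (Z U : repT d -> Prop) : Prop :=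
  exists S : (repT d -> K) -> Prop,
    (forall f, S f -> polyfun f) /\ forall X, U X <-> (Z X /\ ~ vanish S X).

Definition dense_in (d : 'I_n -> nat) (Z U : repT d -> Prop) : Prop :=
  (forall X, U X -> Z X) /\
  forall O, rel_open Z O -> (exists X, O X) -> exists X, O X /\ U X.

Definition compatible (d : 'I_n -> nat) (N : forall i, 'M[K]_(d i)) (X : repT d) : Prop :=
  forall a, N (tgt a) *m X a = X a *m N (src a).

Definition part_starts (l : seq nat) : seq nat :=
  [seq sumn (take m l) | m <- iota 0 (size l)].
Definition jordan_mx (l : seq nat) : 'M[K]_(sumn l) :=
  \matrix_(i, j) (((j : nat) == i.+1) && ((j : nat) \notin part_starts l))%:R.

(* Y is isomorphic to GenRep(nu): there is a dense open subset of the
   N-compatible representations (N_i of Jordan type nu^i) all of whose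
   members are isomorphic to Y. *)
Definition is_GenRep (nu : 'I_n -> seq nat) (e : 'I_n -> nat) (Y : repT e) : Prop :=
  exists U : repT (fun i => sumn (nu i)) -> Prop,
    rel_open (compatible (fun i => jordan_mx (nu i))) U /\
    dense_in (compatible (fun i => jordan_mx (nu i))) U /\
    forall X, U X -> rep_iso X Y.

End Quiver.

Definition interlaced (t : nat) (mu lam : seq nat) : Prop :=
  ((forall j, nth 0 mu j.+1 <= nth 0 mu j) /\
   (forall j, nth 0 mu (t + 2 * j).+1 <= nth 0 lam j <= nth 0 mu (t + 2 * j)))%N.

Definition part_diff (t : nat) (mu lam : seq nat) : seq nat :=
  take t mu ++
  filter (leq 1)
    [seq (nth 0 mu (t + 2 * j)%N + nth 0 mu (t + 2 * j)%N.+1 - nth 0 lam j)%N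
    | j <- iota 0 (size mu)].

Section Reflection.
Variables (n : nat) (A : finType) (src tgt : A -> 'I_n) (k : 'I_n).

Definition rev_src (a : A) : 'I_n :=
  if (src a == k) || (tgt a == k) then tgt a else src a.
Definition rev_tgt (a : A) : 'I_n :=
  if (src a == k) || (tgt a == k) then src a else tgt a.

Definition sigma_part (t : nat) (nu : 'I_n -> seq nat) : 'I_n -> seq nat :=
  fun i => if i == k then part_diff t (adj_part src tgt k nu) (nu k) else nu i.

Variable K : fieldType.

(* the map  (+)_{a : k -> tgt a} W_{tgt a} --> W_k  given by the reversed arrows *)
Definition refl_map (dv e : 'I_n -> nat) (W : repT rev_src rev_tgt K e)
    (x : forall a, 'cV[K]_(dv (tgt a))) : 'cV[K]_(e k) :=
  \sum_(a | src a == k)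
     conform_mx (0 : 'cV[K]_(e k))
       (W a *m conform_mx (0 : 'cV[K]_(e (rev_src a))) (x a)).

(* W is (a representative of) R^-_k(V): W_i = V_i for i <> k, arrows away from
   k unchanged, and  V_k --(f_a)_a--> (+)_a V_{tgt a} --(W_a)_a--> W_k --> 0
   is exact, i.e. W_k is the cokernel with the induced maps. *)
Definition is_reflection (dv : 'I_n -> nat) (V : repT src tgt K dv)
    (e : 'I_n -> nat) (W : repT rev_src rev_tgt K e) : Prop :=
  (forall i, i != k -> e i = dv i) /\
  (forall a, ~~ ((src a == k) || (tgt a == k)) -> W a = conform_mx 0 (V a)) /\
  (forall y : 'cV[K]_(e k), exists x : forall a, 'cV[K]_(dv (tgt a)), refl_map W x = y) /\
  (forall x : forall a, 'cV[K]_(dv (tgt a)),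
     refl_map W x = 0 <->
     exists v : 'cV[K]_(dv k), forall a, src a == k -> x a = V a *m conform_mx 0 v).

End Reflection.

(* Main.v *)
Require Import Defs.
From mathcomp Require Import all_boot all_order all_algebra all_fingroup zify.
From Stdlib Require Import Classical.

(* The representations compatible with N form a linear space, hence an
   irreducible variety, so it suffices to exhibit one nonempty open set of
   representations compatible with sigma_k(nu) all of whose members are
   isomorphic to W.

   Let M_lam, M_mu, M_kap be the K[x]-modules of types nu^k, nu^adj(k) and
   diff(nu^adj(k), nu^k).  Interlacing gives a short exact sequence
     0 -> M_lam -f1-> M_mu -g1-> M_kap -> 0
   which is a direct sum of blocks K[x]/x^l -> K[x]/x^a + K[x]/x^b -> K[x]/x^c
   with a + b = l + c and a >= l, c >= b.  The interlacing condition between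
   different blocks is what makes every homomorphism M_lam -> M_mu of the form
   beta f1 + f1 alpha, and every homomorphism M_mu -> M_kap of the form
   beta g1 + g1 alpha.  So the tangent spaces of the orbits of f1 and g1 under
   automorphisms are everything, and by Cramer's rule maps near f1 (resp. g1)
   are moved to f1 (resp. g1) by automorphisms depending polynomially on them.
   Some V generic for nu therefore has its map out of k equal to
   B^-1 f1 A, and for g near g1 B there is a polynomial choice of f in the
   orbit of f1 with ker g = im f; replacing g by f undoes the reflection and
   lands in the open set of representations isomorphic to V. *)

Set Implicit Arguments. Unset Strict Implicit. Unset Printing Implicit Defensive.
Import GRing.Theory.
Local Open Scope ring_scope.

(** * Nilpotent operators as K[x]-modules *)

Section NilpotentModules.
Variable K : fieldType.

Lemma intertwineX d d' (N : 'M[K]_d) (N' : 'M[K]_d') (H : 'M[K]_(d', d)) m :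
  H *m N = N' *m H -> H *m N ^+ m = N' ^+ m *m H.
Proof.
move=> HN; elim: m => [|m IH]; first by rewrite !expr0 mulmx1 mul1mx.
by rewrite !exprS -!mulmxE mulmxA HN -mulmxA IH mulmxA.
Qed.

(** The polynomial p evaluated at [N], that is, the action of K[x] when x acts as [N]; the explicit
    sum of powers makes sense for d = 0 too. *)
Definition pact d (N : 'M[K]_d) (p : {poly K}) : 'M[K]_d :=
  \sum_(i < size p) p`_i *: N ^+ i.

Lemma pact_widen d (N : 'M[K]_d) (p : {poly K}) n : (size p <= n)%N ->
  pact N p = \sum_(i < n) p`_i *: N ^+ i.
Proof.
move=> le_pn; rewrite /pact (big_ord_widen n (fun i => p`_i *: N ^+ i)) //.
rewrite big_mkcond; apply: eq_bigr => i _; case: ltnP => // le_pi.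
by rewrite nth_default // scale0r.
Qed.

Lemma pactD d (N : 'M[K]_d) p q : pact N (p + q) = pact N p + pact N q.
Proof.
have le := size_polyD p q; set n := maxn _ _ in le.
rewrite (@pact_widen _ _ _ n) // (@pact_widen _ _ p n) ?leq_maxl //.
rewrite (@pact_widen _ _ q n) ?leq_maxr // -big_split /=.
by apply: eq_bigr => i _; rewrite coefD scalerDl.
Qed.

Lemma pact_intertwine d d' (N : 'M[K]_d) (N' : 'M[K]_d') (H : 'M[K]_(d', d)) p :
  H *m N = N' *m H -> H *m pact N p = pact N' p *m H.
Proof.
move=> HN; rewrite /pact mulmx_sumr mulmx_suml; apply: eq_bigr => i _.
by rewrite -scalemxAr -scalemxAl (intertwineX _ HN).
Qed.

Lemma pact_comm d (N : 'M[K]_d) p : N *m pact N p = pact N p *m N.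
Proof. exact: pact_intertwine. Qed.

Lemma pact_commX d (N : 'M[K]_d) p m : N ^+ m *m pact N p = pact N p *m N ^+ m.
Proof. by apply: esym; apply: intertwineX; rewrite pact_comm. Qed.

Lemma pact_mulXn d (N : 'M[K]_d) p m : pact N (p * 'X^m) = N ^+ m *m pact N p.
Proof.
rewrite (@pact_widen _ _ _ (m + size p)); last first.
  by have := size_polyMleq p 'X^m; rewrite size_polyXn; lia.
rewrite big_split_ord /= big1 => [|i _]; last by rewrite coefMXn ltn_ord scale0r.
rewrite add0r mulmx_sumr; apply: eq_bigr => i _.
rewrite coefMXn ltnNge leq_addr /= addKn -scalemxAr.
by rewrite exprD.
Qed.

Lemma exprD_mulmx d (N : 'M[K]_d) (v : 'cV[K]_d) m n :
  N ^+ m *m (N ^+ n *m v) = N ^+ (m + n) *m v.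
Proof. by rewrite mulmxA exprD. Qed.

Lemma nilp_ge d (N : 'M[K]_d) (v : 'cV[K]_d) m n :
  (m <= n)%N -> N ^+ m *m v = 0 -> N ^+ n *m v = 0.
Proof. by move=> /subnK <- h; rewrite -exprD_mulmx h mulmx0. Qed.

(* The vectors [e i] generate a direct sum of cyclic modules K[x]/(x^(o i)),
   where x acts as [N]. *)
Record gens d (N : 'M[K]_d) (I : finType) (o : I -> nat) (e : I -> 'cV[K]_d)
  : Prop := Gens {
  gens_ann : forall i, N ^+ o i *m e i = 0;
  gens_lift : forall d' (N' : 'M[K]_d') (y : I -> 'cV[K]_d'),
    (forall i, N' ^+ o i *m y i = 0) ->
    exists2 H : 'M[K]_(d', d), H *m N = N' *m H & forall i, H *m e i = y i;
  gens_dec : forall m v, (N ^+ m *m v = 0) \/ (forall i, (o i <= m)%N) ->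
    exists p : I -> {poly K}, v = \sum_i N ^+ (o i - m) *m (pact N (p i) *m e i);
  gens_free : forall i q, pact N q *m e i = 0 ->
    forall j, (j < o i)%N -> q`_j = 0 }.

(** [gens_dec] describes the vectors killed by x^m; for m the largest order the factors x^(o i - m)
    are trivial, which leaves plain generation. *)
Lemma gens_span d (N : 'M[K]_d) (I : finType) (o : I -> nat) e :
  gens N o e -> forall v, exists p : I -> {poly K}, v = \sum_i pact N (p i) *m e i.
Proof.
move=> g v.
have lem i : (o i <= \max_j o j)%N by apply: leq_bigmax_cond.
have [p ->] := gens_dec g (m := \max_j o j) (v := v) (or_intror lem).
by exists p; apply: eq_bigr => i _; rewrite (eqP (lem i)) expr0 mul1mx.
Qed.

(** The uniqueness that goes with [gens_lift]: by [gens_span], a homomorphism is determined by its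
    values on the generators. *)
Lemma gens_eqmx d d' (N : 'M[K]_d) (N' : 'M[K]_d') (I : finType) (o : I -> nat) e
    (H H' : 'M[K]_(d', d)) :
  gens N o e -> H *m N = N' *m H -> H' *m N = N' *m H' ->
  (forall i, H *m e i = H' *m e i) -> H = H'.
Proof.
move=> g HN HN' eqH; suff eqv (v : 'cV_d) : H *m v = H' *m v.
  by apply/row_matrixP => i; apply/rowP => j; have /colP/(_ i) := eqv (delta_mx j 0);
     rewrite -!colE !mxE.
have [p ->] := gens_span g v; rewrite !mulmx_sumr; apply: eq_bigr => i _.
by rewrite !mulmxA (pact_intertwine _ HN) (pact_intertwine _ HN') -!mulmxA eqH.
Qed.

Lemma gens_reindex d (N : 'M[K]_d) (I J : finType) (o : I -> nat) e (phi : J -> I) :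
  bijective phi -> gens N o e -> gens N (o \o phi) (e \o phi).
Proof.
move=> bphi g; have [psi phiK psiK] := bphi; split => /=.
- by move=> i; apply: gens_ann.
- move=> d' N' y ann; have [i|H HN He] := gens_lift g (N' := N') (y := y \o psi).
    by have := ann (psi i); rewrite /= psiK.
  by exists H => // i; rewrite He /= phiK.
- move=> m v hv; have [|p ->] := gens_dec g (m := m) (v := v).
    by case: hv => [|le]; [left | right=> i; have := le (psi i); rewrite psiK].
  exists (p \o phi) => /=; rewrite (reindex phi) //; exact: onW_bij.
- by move=> i; apply: gens_free.
Qed.

(** Generators of order 0 are zero vectors, so they may be added, and by [gens_delz] removed; this
    brings two families to index sets of the same size. *)
Lemma gens_addz d (N : 'M[K]_d) (I J : finType) (o : I -> nat) e :
  gens N o e -> gens N (fun x : I + J => if x is inl i then o i else 0%N)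
                       (fun x : I + J => if x is inl i then e i else 0).
Proof.
move=> g; split.
- by case=> [i|j]; [apply: gens_ann | rewrite mulmx0].
- move=> d' N' y ann; have [i|H HN He] := gens_lift g (N' := N') (y := y \o inl).
    exact: (ann (inl i)).
  exists H => // -[i|j] //=; have := ann (inr j).
  by rewrite expr0 mul1mx mulmx0 => ->.
- move=> m v hv; have [|p ->] := gens_dec g (m := m) (v := v).
    by case: hv => [|le]; [left | right=> i; have := le (inl i)].
  exists (fun x => if x is inl i then p i else 0); rewrite big_sumType /=.
  by rewrite [X in _ + X]big1 ?addr0 // => j _; rewrite !mulmx0.
- by case=> [i|j] q //; apply: gens_free.
Qed.

Lemma gens_delz d (N : 'M[K]_d) (I J : finType) (o : I + J -> nat) e :
  (forall j, o (inr j) = 0%N) -> gens N o e -> gens N (o \o inl) (e \o inl).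
Proof.
move=> o0 g; have e0 j : e (inr j) = 0.
  by have := gens_ann g (inr j); rewrite o0 expr0 mul1mx.
split => /=.
- by move=> i; apply: gens_ann.
- move=> d' N' y ann.
  have [[i|j]|H HN He] := gens_lift g (N' := N')
                            (y := fun x => if x is inl i then y i else 0).
  + exact: ann.
  + by rewrite mulmx0.
  by exists H => // i; rewrite He.
- move=> m v hv; have [|p ->] := gens_dec g (m := m) (v := v).
    by case: hv => [|le]; [left | right; case=> [i //|j]; rewrite o0].
  exists (p \o inl); rewrite big_sumType /= [X in _ + X]big1 ?addr0 // => j _.
  by rewrite e0 !mulmx0.
- by move=> i; apply: gens_free.
Qed.

(** [perm_iotaP] writes one list of values as a rearrangement of positions in the other; read
    through the enumerations, these positions give the bijection. The empty case comes first because
    [nth] needs a default index. *)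
Lemma perm_map_bij (I J : finType) (T : eqType) (f : I -> T) (g : J -> T) :
  perm_eq [seq f i | i <- enum I] [seq g j | j <- enum J] ->
  exists2 phi : J -> I, bijective phi & forall j, g j = f (phi j).
Proof.
move=> peq; have eqc : #|I| = #|J|.
  by have := perm_size peq; rewrite !size_image.
have [j0|J0] := pickP J; last first.
  have noJ (j : J) : False by have := J0 j.
  have noI (i : I) : False by have := fintype0 i; apply; rewrite eqc; apply: eq_card0.
  exists (fun j => False_rect I (noJ j)); last by move=> j; case: (noJ j).
  by exists (fun i => False_rect J (noI i)) => x; [case: (noJ x) | case: (noI x)].
have i0 : I by apply: (enum_val (A := predT)); rewrite eqc; exact: (enum_rank j0).
have [Is pIs eqg] : exists2 Is, perm_eq Is (iota 0 #|I|) &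
    [seq g j | j <- enum J] = [seq nth (f i0) [seq f i | i <- enum I] n | n <- Is].
  by rewrite perm_sym in peq; have [Is] := perm_iotaP (f i0) peq;
     rewrite size_image => p e; exists Is.
have sIs : size Is = #|J| by rewrite (perm_size pIs) size_iota.
pose phi (j : J) := nth i0 (enum I) (nth 0%N Is (enum_rank j)).
have ltI (j : J) : (nth 0%N Is (enum_rank j) < #|I|)%N.
  have: nth 0%N Is (enum_rank j) \in Is by rewrite mem_nth ?sIs ?ltn_ord.
  by rewrite (perm_mem pIs) mem_iota add0n.
exists phi => [|j].
  apply: inj_card_bij; last by rewrite eqc.
  move=> x y /eqP; rewrite /phi nth_uniq -?cardE ?ltI ?enum_uniq //.
  rewrite nth_uniq ?sIs // ?(perm_uniq pIs) ?iota_uniq // => /eqP/val_inj.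
  exact: enum_rank_inj.
have := congr1 (fun s => nth (f i0) s (enum_rank j)) eqg.
rewrite (nth_map j0) -?cardE // nth_enum_rank => ->.
by rewrite (nth_map 0%N) ?sIs // (nth_map i0) // -cardE.
Qed.

Lemma count_map_enum (I : finType) (T : eqType) (f : I -> T) (P : pred T) :
  count P [seq f i | i <- enum I] = (\sum_(i : I) P (f i))%N.
Proof. by rewrite count_map -sum1_count big_mkcond big_enum /=. Qed.

(** Only the multiset of positive orders matters. Each family is padded by as many zeros as the
    other has members; the padded lists then have equal length, hence equally many zeros, and a
    bijection matches them. *)
Lemma gens_count d (N : 'M[K]_d) (I J : finType) (o : I -> nat) (o' : J -> nat) e :
  (forall p, (0 < p)%N -> \sum_i (o i == p) = \sum_j (o' j == p))%N ->
  gens N o e -> exists e', gens N o' e'.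
Proof.
move=> cnt g.
pose f (x : I + J) := if x is inl i then o i else 0%N.
pose h (x : J + I) := if x is inl j then o' j else 0%N.
have [phi bphi eqh] : exists2 phi, bijective phi & forall x, h x = f (phi x).
  apply: perm_map_bij.
  have cnt0 p : (0 < p)%N -> count_mem p (map f (enum {: I + J})) =
                count_mem p (map h (enum {: J + I})).
    move=> p0; rewrite !count_map_enum !big_sumType /= cnt //.
    by congr addn; rewrite !big1 // => ? _; case: p p0.
  set s1 := map f _ in cnt0 *; set s2 := map h _ in cnt0 *.
  have fpos (s : seq nat) p : count_mem p (filter (leq 1) s) =
      (if (0 < p)%N then count_mem p s else 0)%N.
    rewrite count_filter; case: ltnP => p0.
      by apply: eq_count => x /=; case: eqP => // ->.
    rewrite (eq_count (a2 := pred0)) ?count_pred0 // => x /=.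
    by case: eqP => // ->; rewrite ltnNge p0.
  have pos : perm_eq (filter (leq 1) s1) (filter (leq 1) s2).
    by apply/allP => p _; apply/eqP; rewrite !fpos; case: ifP => // /cnt0.
  have z0 (s : seq nat) : count_mem 0%N s = (size s - size (filter (leq 1) s))%N.
    rewrite size_filter -(count_predC (leq 1) s) addKn; apply: eq_count => x /=.
    by rewrite -leqn0 leqNgt.
  apply/allP => -[|p] _; apply/eqP; last exact: cnt0.
  by rewrite !z0 (perm_size pos) !size_image !card_sum addnC.
have g' := gens_reindex bphi (gens_addz J g).
have eqo : (fun x : I + J => if x is inl i then o i else 0%N) \o phi =1 h by move=> x; rewrite eqh.
have gh : gens N h ((fun x : I + J => if x is inl i then e i else 0) \o phi).
  case: g' => a1 a2 a3 a4; split.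
  - by move=> i; rewrite -eqo.
  - by move=> d' N' y ann; apply: a2 => i; rewrite eqo.
  - move=> m v hv; have [|p ->] := a3 m v.
      by case: hv; [left | move=> le; right=> i; rewrite eqo].
    by exists p; apply: eq_bigr => i _; rewrite eqo.
  - by move=> i q h0 j; rewrite -eqo; apply: a4.
by eexists; exact: (gens_delz (fun=> erefl) gh).
Qed.

(** The inclusions [E b] and projections [Pr b] present [N] as the direct sum of the [NB b], so
    every property in [gens] is checked component by component. *)
Lemma gens_sum d (N : 'M[K]_d) (B : finType) (D : B -> nat) (NB : forall b, 'M[K]_(D b))
    (E : forall b, 'M[K]_(d, D b)) (Pr : forall b, 'M[K]_(D b, d))
    (I : B -> finType) (o : forall b, I b -> nat) (e : forall b, I b -> 'cV[K]_(D b)) :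
  (forall b, Pr b *m E b = 1%:M) ->
  (forall b b', b != b' -> Pr b *m E b' = 0) ->
  \sum_b E b *m Pr b = 1%:M ->
  (forall b, E b *m NB b = N *m E b) -> (forall b, Pr b *m N = NB b *m Pr b) ->
  (forall b, gens (NB b) (@o b) (@e b)) ->
  gens N (fun x : {b : B & I b} => o _ (tagged x)) (fun x => E _ *m e _ (tagged x)).
Proof.
move=> PE PE0 EP NE PN g; split.
- case=> b i /=; rewrite mulmxA -(intertwineX _ (NE b)) -mulmxA.
  by rewrite (gens_ann (g b)) mulmx0.
- move=> d' N' y ann.
  have /fin_all_exists2[H HN He] : forall b, exists2 H : 'M_(d', D b),
      H *m NB b = N' *m H & forall i, H *m e b i = y (Tagged I i).
    by move=> b; apply: gens_lift (g b) _ _ _ _ => i; exact: (ann (Tagged I i)).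
  exists (\sum_b H b *m Pr b).
    rewrite mulmx_suml mulmx_sumr; apply: eq_bigr => b _.
    by rewrite -mulmxA PN !mulmxA HN.
  case=> b i /=; rewrite mulmx_suml (bigD1 b) //= big1 ?addr0 => [|b' nb].
    by rewrite -mulmxA (mulmxA (Pr b)) PE mul1mx He.
  by rewrite -mulmxA (mulmxA (Pr b')) PE0 // mul0mx mulmx0.
- move=> m v hv.
  have /fin_all_exists[p Hp] : forall b, exists p : I b -> {poly K},
     Pr b *m v = \sum_i NB b ^+ (o b i - m) *m (pact (NB b) (p i) *m e b i).
    move=> b; apply: (gens_dec (g b)); case: hv => [h|le]; [left|right=> i].
      by rewrite mulmxA -(intertwineX _ (PN b)) -mulmxA h mulmx0.
    exact: (le (Tagged I i)).
  exists (fun x => p _ (tagged x)).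
  rewrite -[LHS]mul1mx -EP mulmx_suml.
  under eq_bigr => b _ do rewrite -mulmxA Hp mulmx_sumr.
  rewrite (sig_big_dep _ (fun b => predT)) /=; apply: eq_bigr => -[b i] _ /=.
  rewrite !mulmxA (intertwineX _ (NE b)); congr mulmx; rewrite -!mulmxA; congr mulmx.
  exact: pact_intertwine.
- case=> b i q /= h; apply: (gens_free (g b)).
  rewrite -[LHS]mul1mx -(PE b) -!mulmxA (mulmxA (E b)) (pact_intertwine _ (NE b)).
  by rewrite -mulmxA h mulmx0.
Qed.

End NilpotentModules.

(** * Jordan matrices as direct sums of cyclic modules *)

Section Jordan.
Variable K : fieldType.

Lemma sum_eq_ord (r x : nat) (F : 'I_r -> K) :
  \sum_(k < r) (nat_of_ord k == x)%:R * F k = (if insub x is Some k then F k else 0).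
Proof.
case: insubP => [k xr <-|nxr].
  rewrite (bigD1 k) //= eqxx mul1r big1 ?addr0 // => i.
  by rewrite -val_eqE /= => /negbTE->; rewrite mul0r.
by rewrite big1 // => i _; case: eqP => [ix|]; [move: nxr; rewrite -ix ltn_ord | rewrite mul0r].
Qed.

Lemma sum_eq_ordE (r : nat) (x : 'I_r) (F : 'I_r -> K) :
  \sum_(k < r) (nat_of_ord k == x)%:R * F k = F x.
Proof. by rewrite sum_eq_ord valK. Qed.

Definition shift_mx r : 'M[K]_r := \matrix_(i, j) (nat_of_ord j == i.+1)%:R.

Lemma shift_mxX r m i j : (shift_mx r ^+ m) i j = (nat_of_ord j == i + m)%N%:R.
Proof.
elim: m i j => [|m IH] i j; first by rewrite expr0 mxE addn0 -val_eqE eq_sym.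
rewrite exprS -mulmxE mxE; under eq_bigr => k _ do rewrite mxE IH.
rewrite (sum_eq_ord _ (fun k : 'I_r => (nat_of_ord j == k + m)%N%:R)).
case: insubP => [k _ -> //|]; rewrite ?addSnnS // => ni.
by case: eqP => // ej; have := ltn_ord j; lia.
Qed.

Lemma mul_shift_mxX r m (v : 'cV[K]_r) i :
  (shift_mx r ^+ m *m v) i 0 = if insub (i + m)%N is Some k then v k 0 else 0.
Proof.
rewrite mxE; under eq_bigr => k _ do rewrite shift_mxX.
by rewrite (sum_eq_ord _ (fun k : 'I_r => v k 0)).
Qed.

(** A single block lowers the index of basis vectors by one, so the last one generates, and
    coordinate i of its multiple by p is the coefficient of p at [r.-1 - i]. *)
Lemma gens_shift r :
  exists e : unit -> 'cV[K]_r, gens (shift_mx r) (fun _ : unit => r) e.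
Proof.
pose e : 'cV[K]_r := \col_i (i.+1 == r)%:R.
have pe p i : (pact (shift_mx r) p *m e) i 0 = p`_(r.-1 - i).
  rewrite (@pact_widen _ _ _ _ (maxn (size p) r)) ?leq_maxl // mulmx_suml summxE.
  have lt : (r.-1 - i < maxn (size p) r)%N by have := ltn_ord i; lia.
  rewrite (bigD1 (Ordinal lt)) //= big1 ?addr0 => [|k nk].
    rewrite -scalemxAl mxE mul_shift_mxX; case: insubP => [j _ ej|]; last by have := ltn_ord i; lia.
    by rewrite mxE ej (_ : _ == _) ?mulr1 //; have := ltn_ord i; lia.
  rewrite -scalemxAl mxE mul_shift_mxX; case: insubP => [j _ ej|]; rewrite ?mulr0 //.
  rewrite mxE ej; case: eqP => [ek|]; rewrite ?mulr0 //.
  by case/negP: nk; rewrite -val_eqE /=; apply/eqP; lia.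
exists (fun=> e); split.
- move=> _; apply/colP => i; rewrite mul_shift_mxX mxE.
  by case: insubP => // j; have := ltn_ord i; lia.
(* Basis vector j is x^(r.-1 - j) times the generator, which forces column j of [H]. *)
- move=> d' N' y ann; pose H : 'M_(d', r) := \matrix_(i, j) (N' ^+ (r.-1 - j) *m y tt) i 0.
  have HE i j : H i j = (N' ^+ (r.-1 - j) *m y tt) i 0 by rewrite mxE.
  exists H.
    apply/matrixP => i j.
    have -> : (N' *m H) i j = (N' ^+ (r.-1 - j).+1 *m y tt) i 0.
      by rewrite exprS -mulmxE -mulmxA !mxE; apply: eq_bigr => k _; rewrite HE.
    rewrite mxE; under eq_bigr => k _ do rewrite [shift_mx r _ _]mxE mulrC.
    case: j => -[|j] ltj /=.
      rewrite big1 => [|k _]; last by rewrite mul0r.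
      by rewrite subn0 prednK // ann mxE.
    have ltj' : (j < r)%N by lia.
    rewrite (bigD1 (Ordinal ltj')) //= eqxx mul1r big1 ?addr0 => [|k].
      by rewrite HE (_ : (r.-1 - j.+1).+1 = r.-1 - j)%N //; lia.
    by rewrite -val_eqE /= eqSS eq_sym => /negbTE->; rewrite mul0r.
  case; apply/colP => i; rewrite mxE.
  case: (posnP r) => [r0|r0].
    have -> : y tt = 0 by have := ann tt; rewrite r0 expr0 mul1mx.
    by rewrite mxE big1 // => j; have := ltn_ord j; rewrite {2}r0.
  have lt : (r.-1 < r)%N by lia.
  rewrite (bigD1 (Ordinal lt)) //= HE [e _ _]mxE /= prednK // eqxx mulr1 subnn expr0 mul1mx.
  rewrite big1 ?addr0 // => k; rewrite -val_eqE /= => nk.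
  rewrite [e _ _]mxE; case: eqP => [ek|]; rewrite ?mulr0 //.
  by case/eqP: nk; lia.
- move=> m v hv; pose vv n := if insub n is Some k then v (k : 'I_r) 0 else 0.
  (* [v] is supported on its first [minn m r] coordinates; these, in reverse order, are the
     coefficients, and x^(r - m) shifts them into place. *)
  exists (fun _ => \poly_(i < minn m r) vv ((minn m r).-1 - i)%N).
  rewrite big_const cardT enumT unlock /= addr0; apply/colP => i.
  have vvi : vv i = v i 0 by rewrite /vv valK.
  rewrite mul_shift_mxX; have ltr := ltn_ord i.
  case: (ltnP i m) => im.
    case: insubP => [k _ ek|]; last by lia.
    rewrite pe ek coef_poly (_ : _ < minn m r)%N; last by lia.
    by rewrite -vvi; congr vv; lia.
  have v0 : v i 0 = 0.
    case: hv => [hv|/(_ tt)]; last by lia.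
    have lt : (i - m < r)%N by lia.
    have := congr1 (fun w : 'cV_r => w (Ordinal lt) 0) hv; rewrite /= mul_shift_mxX mxE /=.
    by rewrite subnK // valK.
  by rewrite v0; case: insubP => // k; lia.
- case=> q h j ltj.
  have lt : (r.-1 - j < r)%N by lia.
  have := congr1 (fun w : 'cV_r => w (Ordinal lt) 0) h; rewrite /= pe mxE /=.
  by rewrite (_ : _ - _ = j)%N //; lia.
Qed.

Lemma sumn_take_mono (l : seq nat) m n :
  (m <= n)%N -> (sumn (take m l) <= sumn (take n l))%N.
Proof.
move=> le; rewrite -[take n l](cat_take_drop m) sumn_cat take_takel //; exact: leq_addr.
Qed.

(** Partial sums are monotone, and the index lies strictly below the sum of the first [b.+1] parts,
    so it can only equal the sum of the first [b] parts. *)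
Lemma mem_part_starts (l : seq nat) b c : (c < nth 0 l b)%N ->
  (flatten_index l b c \in part_starts l) = (c == 0)%N.
Proof.
move=> lt; have ltb : (b < size l)%N.
  by rewrite ltnNge; apply/negP => le; move: lt; rewrite nth_default.
apply/mapP/eqP => [[m]|->]; last first.
  by exists b; rewrite ?mem_iota // /flatten_index addn0.
rewrite mem_iota add0n /= /flatten_index => ltm e.
case: (leqP m b) => [/(sumn_take_mono l)|/(sumn_take_mono l)]; first lia.
by rewrite (take_nth 0%N) // sumn_rcons; lia.
Qed.

(** [flatten_index] cuts the coordinates into consecutive blocks, on each of which the Jordan matrix
    is a shift; [gens_sum] assembles the generators of [gens_shift]. *)
Lemma gens_jordan (l : seq nat) :
  exists e, gens (jordan_mx K l) (fun x : 'I_(size l) => nth 0%N l x) e.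
Proof.
pose fi (b : 'I_(size l)) (c : 'I_(nth 0%N l b)) : nat := flatten_index l b c.
have fiP b c : (@fi b c < sumn l)%N by apply: flatten_indexP.
pose fo b c : 'I_(sumn l) := Ordinal (@fiP b c).
pose E b : 'M[K]_(sumn l, nth 0%N l (nat_of_ord b)) :=
  \matrix_(r, c) (nat_of_ord r == @fo b c)%:R.
have fiI b c b' c' : @fi b c = @fi b' c' -> (b = b') /\ (nat_of_ord c = c').
  move=> e; split; [apply: val_inj|].
    rewrite /= -(flatten_indexKl (ltn_ord c)) -(flatten_indexKl (ltn_ord c')).
    by congr reshape_index.
  by rewrite -(flatten_indexKr (ltn_ord c)) -(flatten_indexKr (ltn_ord c')); congr reshape_offset.
have /fin_all_exists[e He] b := gens_shift (nth 0%N l (nat_of_ord (b : 'I_(size l)))).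
have g : gens (jordan_mx K l) (fun x : {b : 'I_(size l) & unit} => nth 0%N l (tag x))
              (fun x => E (tag x) *m e (tag x) (tagged x)).
  apply: (@gens_sum K _ _ _ _ _ E (fun b => (E b)^T) (fun _ => unit)
            (fun b _ => nth 0%N l (nat_of_ord b)) e _ _ _ _ _ He).
  - move=> b; apply/matrixP => c c'; rewrite !mxE.
    under eq_bigr => r _ do rewrite !mxE.
    rewrite (sum_eq_ordE _ (fun r => (nat_of_ord r == fo b c')%:R)) /=; congr ((nat_of_bool _)%:R).
    by apply/eqP/eqP => [/fiI[_]/val_inj //|->].
  - move=> b b' nb; apply/matrixP => c c'; rewrite !mxE.
    under eq_bigr => r _ do rewrite !mxE.
    rewrite (sum_eq_ordE _ (fun r => (nat_of_ord r == fo b' c')%:R)) /=.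
    by case: eqP => // /fiI[eb _]; rewrite eb eqxx in nb.
  - apply/matrixP => r r'; rewrite summxE mxE.
    have ltb := reshape_indexP (ltn_ord r); pose b := Ordinal ltb.
    have ltc := reshape_offsetP (ltn_ord r); pose c : 'I_(nth 0%N l b) := Ordinal ltc.
    have er : nat_of_ord r = @fi b c by rewrite /fi /= reshape_indexK.
    rewrite (bigD1 b) //= big1 ?addr0 => [|b' nb]; last first.
      rewrite mxE big1 // => c' _; rewrite !mxE er; case: eqP; rewrite ?mul0r //.
      by move=> /fiI[eb _]; rewrite eb eqxx in nb.
    rewrite mxE (bigD1 c) //= big1 ?addr0 => [|c' nc].
      by rewrite !mxE er eqxx mul1r -val_eqE /= eq_sym er.
    rewrite !mxE er; case: eqP; rewrite ?mul0r //= => /fiI[_ ec].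
    by case/eqP: nc; apply: val_inj.
  - move=> b; apply/matrixP => r c; rewrite !mxE.
    under eq_bigr => c' _ do rewrite !mxE.
    under [RHS]eq_bigr => r' _ do rewrite !mxE mulrC.
    rewrite (sum_eq_ordE _ (fun r' =>
      ((nat_of_ord r' == r.+1) && (nat_of_ord r' \notin part_starts l))%:R)) /=.
    rewrite mem_part_starts ?ltn_ord // /fi /flatten_index.
    case: c => -[|c] ltc /=.
      by rewrite andbF big1 // => c' _; rewrite mulr0.
    rewrite andbT; have ltc' : (c < nth 0 l b)%N by lia.
    rewrite (bigD1 (Ordinal ltc')) //= eqxx mulr1 big1 ?addr0 => [|c'].
      by rewrite /fi /flatten_index addnS eqSS eq_sym.
    by rewrite -val_eqE /= eqSS eq_sym => /negbTE->; rewrite mulr0.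
  - move=> b; apply/matrixP => c r; rewrite !mxE.
    under eq_bigr => r' _ do rewrite !mxE.
    rewrite (sum_eq_ordE _ (fun r' =>
      ((nat_of_ord r == r'.+1) && (nat_of_ord r \notin part_starts l))%:R)) /=.
    under [RHS]eq_bigr => c' _ do rewrite !mxE.
    rewrite (sum_eq_ord _ (fun c' => (nat_of_ord r == fo b c')%:R)).
    (* After the last row of block [b] the next index, if there is one, is the sum of the first
       [b.+1] parts, a block start, where the entry of [jordan_mx] is zero. *)
    case: insubP => [c' _ ec|]; last first.
      rewrite -leqNgt => le; case: eqP => //= er.
      have -> : nat_of_ord r \in part_starts l; last by [].
      have lec : c.+1 = nth 0%N l b by have := ltn_ord c; lia.
      have er' : nat_of_ord r = sumn (take b.+1 l).
        by rewrite (take_nth 0%N) // sumn_rcons er /fi /flatten_index; lia.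
      apply/mapP; exists b.+1 => //; rewrite mem_iota add0n /= ltnNge; apply/negP => leb.
      by have := ltn_ord r; rewrite {1}er' take_oversize ?ltnn.
    rewrite /= /fi /flatten_index -addnS -ec; case: eqP => //= ->.
    by rewrite (@mem_part_starts l b c') ?ltn_ord // ec.
have [p p0|e' g'] := gens_count (o' := fun x : 'I_(size l) => nth 0%N l x) _ g; last by exists e'.
transitivity (\sum_(b < size l) \sum_(u : unit) nat_of_bool (nth 0%N l b == p))%N.
  by rewrite (sig_big_dep _ (fun b => predT)); apply: eq_bigr.
by apply: eq_bigr => b _; rewrite big_const cardT enumT unlock /= addn0.
Qed.
End Jordan.

(** * The generic short exact sequence *)

Section Core.
Variable K : fieldType.

Definition right_exact m l c (F : 'M[K]_(m, l)) (G : 'M[K]_(c, m)) : Prop :=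
  (forall y : 'cV_c, exists x, G *m x = y) /\
  (forall x : 'cV_m, G *m x = 0 <-> exists v, x = F *m v).

(* The tangent space at [g] of the orbit of [g] under pairs of automorphisms is
   the whole space of homomorphisms. *)
Definition full_tangent da db (Na : 'M[K]_da) (Nb : 'M[K]_db) (g : 'M[K]_(db, da))
  : Prop :=
  forall h : 'M[K]_(db, da), h *m Na = Nb *m h -> exists alpha beta,
    [/\ alpha *m Nb = Nb *m alpha, beta *m Na = Na *m beta
      & h = alpha *m g + g *m beta].

Variables (I : finType) (a b c l : I -> nat).
Hypothesis (bl : forall i, (b i <= l i)%N) (la : forall i, (l i <= a i)%N).
Hypothesis (ablc : forall i, (a i + b i = l i + c i)%N).
(** Here [r] is the order of a generator in block [i]. Each alternative lets elements killed by x^r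
    be moved through block [j]; in the third also [b j = l j], and the block sequence splits. *)
Hypothesis sep : forall i j r, i != j -> (r = a i) \/ (r = b i) ->
  [\/ (a j <= r)%N, (r <= b j)%N | a j = c j].

Variables (dl dm dc : nat) (Nl : 'M[K]_dl) (Nm : 'M[K]_dm) (Nc : 'M[K]_dc).
Variables (w : I -> 'cV[K]_dl) (e : I + I -> 'cV[K]_dm) (u : I -> 'cV[K]_dc).
Hypothesis gw : gens Nl l w.
Hypothesis ge : gens Nm (fun x => match x with inl i => a i | inr i => b i end) e.
Hypothesis gu : gens Nc c u.

Let bc i : (b i <= c i)%N. Proof. by move: (ablc i) (la i); lia. Qed.
Let ca i : (c i <= a i)%N. Proof. by move: (ablc i) (bl i); lia. Qed.
Let ann_a i : Nm ^+ a i *m e (inl i) = 0. Proof. exact: (gens_ann ge (inl i)). Qed.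
Let ann_b i : Nm ^+ b i *m e (inr i) = 0. Proof. exact: (gens_ann ge (inr i)). Qed.
Let ann_u i : Nc ^+ c i *m u i = 0. Proof. exact: gens_ann gu i. Qed.
Let ann_w i : Nl ^+ l i *m w i = 0. Proof. exact: gens_ann gw i. Qed.

Let pcom d (N : 'M[K]_d) m p (v : 'cV[K]_d) :
  N ^+ m *m (pact N p *m v) = pact N p *m (N ^+ m *m v).
Proof. by rewrite !mulmxA pact_commX. Qed.

(** * The tangent space at the surjection *)

Section Surjection.
Variable g : 'M[K]_(dc, dm).
Hypothesis gN : g *m Nm = Nc *m g.
Hypothesis g_a : forall i, g *m e (inl i) = u i.
Hypothesis g_b : forall i, g *m e (inr i) = Nc ^+ (c i - b i) *m u i.

Let gX m (v : 'cV[K]_dm) : g *m (Nm ^+ m *m v) = Nc ^+ m *m (g *m v).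
Proof. by rewrite !mulmxA (intertwineX _ gN). Qed.
Let gP p (v : 'cV[K]_dm) : g *m (pact Nm p *m v) = pact Nc p *m (g *m v).
Proof. by rewrite !mulmxA (pact_intertwine _ gN). Qed.

(** Lifts an element of the cyclic module of [u j] killed by x^r to one killed by x^r. If [a j <= r]
    or [a j = c j], a multiple of [e (inl j)] serves; if [r <= b j], a multiple of [e (inr j)],
    since everything killed by x^r is then divisible by x^(c j - b j). *)
Lemma lift_torsion j r p : [\/ (a j <= r)%N, (r <= b j)%N | a j = c j] ->
  exists2 v : 'cV[K]_dm, g *m v = Nc ^+ (c j - r) *m (pact Nc p *m u j) & Nm ^+ r *m v = 0.
Proof.
case=> [le|le|eq].
- exists (pact Nm p *m e (inl j)).
    have -> : (c j - r = 0)%N by move: (ca j); lia.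
    by rewrite expr0 mul1mx gP g_a.
  by rewrite pcom (nilp_ge le (ann_a j)) mulmx0.
- exists (Nm ^+ (b j - r) *m (pact Nm p *m e (inr j))).
    rewrite gX gP g_b -pcom exprD_mulmx; congr (_ ^+ _ *m _); move: (bc j); lia.
  by rewrite exprD_mulmx pcom subnKC // ann_b mulmx0.
- exists (Nm ^+ (c j - r) *m (pact Nm p *m e (inl j))).
    by rewrite gX gP g_a.
  rewrite exprD_mulmx pcom (nilp_ge _ (ann_a j)) ?mulmx0 //; lia.
Qed.

(** The component of [h *m e (inl i)] along [u i] is absorbed by the endomorphism [al] of the
    target. What remains has torsion bounded by [a i] or [b i] and lifts by [lift_torsion]; the
    lifts are the values of [be] minus nothing else. On [e (inr i)] the component in block [i]
    itself falls under [r <= b i]. *)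
Lemma surjection_tangent : full_tangent Nm Nc g.
Proof.
move=> h hN.
have hX m (v : 'cV[K]_dm) : h *m (Nm ^+ m *m v) = Nc ^+ m *m (h *m v).
  by rewrite !mulmxA (intertwineX _ hN).
have /fin_all_exists[p hp] i : exists p : I -> {poly K},
    h *m e (inl i) = \sum_j Nc ^+ (c j - a i) *m (pact Nc (p j) *m u j).
  by apply: gens_dec gu _ _ _; left; rewrite -hX ann_a mulmx0.
have [i|al alN al_u] := gens_lift gu (N' := Nc) (y := fun i => pact Nc (p i i) *m u i).
  by rewrite pcom ann_u mulmx0.
have alX m (v : 'cV[K]_dc) : al *m (Nc ^+ m *m v) = Nc ^+ m *m (al *m v).
  by rewrite !mulmxA (intertwineX _ alN).
have /fin_all_exists2[xa xa_g xa_ann] i : exists2 x,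
    g *m x = h *m e (inl i) - al *m u i & Nm ^+ a i *m x = 0.
  have /fin_all_exists2[x xg x0] j : exists2 x : 'cV[K]_dm, g *m x =
      (if j == i then 0 else Nc ^+ (c j - a i) *m (pact Nc (p i j) *m u j)) & Nm ^+ a i *m x = 0.
    have [_|ne] := eqVneq j i; first by exists 0; rewrite mulmx0.
    by apply: lift_torsion; apply: (@sep i); [rewrite eq_sym | left].
  exists (\sum_j x j); last by rewrite mulmx_sumr big1.
  rewrite mulmx_sumr hp al_u (bigD1 i) //= [in RHS](bigD1 i) //= xg eqxx add0r.
  have -> : (c i - a i = 0)%N by move: (ca i); lia.
  rewrite expr0 mul1mx addrAC subrr add0r.
  by apply: eq_bigr => j nj; rewrite xg (negbTE nj).
have /fin_all_exists2[xb xb_g xb_ann] i : exists2 x,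
    g *m x = h *m e (inr i) - Nc ^+ (c i - b i) *m (al *m u i) & Nm ^+ b i *m x = 0.
  have [|q ->] := gens_dec gu (m := b i)
      (v := h *m e (inr i) - Nc ^+ (c i - b i) *m (al *m u i)).
    left; rewrite mulmxBr -hX ann_b mulmx0 sub0r exprD_mulmx subnKC ?bc //.
    by rewrite -alX ann_u mulmx0 oppr0.
  have /fin_all_exists2[x xg x0] j : exists2 x : 'cV[K]_dm, g *m x =
      Nc ^+ (c j - b i) *m (pact Nc (q j) *m u j) & Nm ^+ b i *m x = 0.
    apply: lift_torsion; have [->|ne] := eqVneq j i; first by constructor 2.
    by apply: (@sep i); [rewrite eq_sym | right].
  exists (\sum_j x j); last by rewrite mulmx_sumr big1.
  by rewrite mulmx_sumr; apply: eq_bigr => j _.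
have [[i|i]|be beN be_e] := gens_lift ge (N' := Nm)
    (y := fun x => match x with inl i => xa i | inr i => xb i end); [exact: xa_ann|exact: xb_ann|].
exists al, be; split => //.
have gal : (al *m g + g *m be) *m Nm = Nc *m (al *m g + g *m be).
  by rewrite mulmxDl mulmxDr -!mulmxA gN beN !mulmxA gN alN.
apply: (gens_eqmx ge hN gal) => -[i|i]; rewrite mulmxDl -!mulmxA be_e.
  by rewrite g_a xa_g addrC subrK.
by rewrite g_b xb_g alX addrC subrK.
Qed.

End Surjection.

(** * The tangent space at the injection *)

Section Injection.
Variable f : 'M[K]_(dm, dl).
Hypothesis fN : f *m Nl = Nm *m f.
Hypothesis f_w : forall i, f *m w i = Nm ^+ (a i - l i) *m e (inl i) - e (inr i).

Let fX m (v : 'cV[K]_dl) : f *m (Nl ^+ m *m v) = Nm ^+ m *m (f *m v).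
Proof. by rewrite !mulmxA (intertwineX _ fN). Qed.
Let fP p (v : 'cV[K]_dl) : f *m (pact Nl p *m v) = pact Nm p *m (f *m v).
Proof. by rewrite !mulmxA (pact_intertwine _ fN). Qed.

(** Dual to [lift_torsion]: a value prescribed on [w i] is extended along [f] to values [x.1], [x.2]
    on the generators of orders [a i], [b i]. In the first case all goes to [x.1], in the other two
    to [x.2]. *)
Lemma extend_torsion i r p (v : 'cV[K]_dm) : Nm ^+ r *m v = 0 ->
  [\/ (a i <= r)%N, (r <= b i)%N | a i = c i] ->
  exists x, [/\ Nm ^+ (a i - l i) *m x.1 - x.2 = Nm ^+ (r - l i) *m (pact Nm p *m v),
     Nm ^+ a i *m x.1 = 0 & Nm ^+ b i *m x.2 = 0].
Proof.
move=> v0; case=> [le|le|eq].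
- exists (Nm ^+ (r - a i) *m (pact Nm p *m v), 0) => /=.
  split; rewrite ?mulmx0 ?subr0 ?exprD_mulmx //.
    by congr (_ ^+ _ *m _); move: (la i); lia.
  by rewrite pcom subnKC // v0 mulmx0.
- exists (0, - (pact Nm p *m v)) => /=; rewrite !mulmx0 sub0r opprK.
  have -> : (r - l i = 0)%N by move: (bl i); lia.
  by rewrite expr0 mul1mx mulmxN pcom (nilp_ge le v0) mulmx0 oppr0.
- exists (0, - (Nm ^+ (r - l i) *m (pact Nm p *m v))) => /=.
  split; rewrite ?mulmx0 ?sub0r ?opprK //.
  rewrite mulmxN exprD_mulmx pcom (nilp_ge _ v0) ?mulmx0 ?oppr0 //.
  by move: (ablc i); lia.
Qed.

(** Only the component of [h *m w i] along [e (inr i)] may fail to extend; the endomorphism [al] of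
    the source trades it for a multiple of [e (inl i)], and the rest extends by [extend_torsion] to
    define [be]. *)
Lemma injection_tangent : full_tangent Nl Nm f.
Proof.
move=> h hN.
have hX m (v : 'cV[K]_dl) : h *m (Nl ^+ m *m v) = Nm ^+ m *m (h *m v).
  by rewrite !mulmxA (intertwineX _ hN).
have /fin_all_exists[p hp] i : exists p : I + I -> {poly K},
    h *m w i = \sum_j Nm ^+ ((match j with inl i => a i | inr i => b i end) - l i)
                     *m (pact Nm (p j) *m e j).
  by apply: gens_dec ge _ _ _; left; rewrite -hX ann_w mulmx0.
have [i|al alN al_w] := gens_lift gw (N' := Nl) (y := fun i => - (pact Nl (p i (inr i)) *m w i)).
  by rewrite mulmxN pcom ann_w mulmx0 oppr0.
have /fin_all_exists[x xP] i : exists x,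
    [/\ Nm ^+ (a i - l i) *m x.1 - x.2 = h *m w i - f *m (al *m w i),
     Nm ^+ a i *m x.1 = 0 & Nm ^+ b i *m x.2 = 0].
  (* [T j] are the terms of [h *m w i - f *m (al *m w i)]: the term along [e (inr i)] is cancelled
     and x^(a i - l i) p [e (inl i)] takes its place. *)
  pose T (j : I + I) := if j == inr i
    then Nm ^+ (a i - l i) *m (pact Nm (p i (inr i)) *m e (inl i)) else
    Nm ^+ ((match j with inl i => a i | inr i => b i end) - l i)
      *m (pact Nm (p i j) *m e j).
  have /fin_all_exists[x xP] (j : I + I) : exists x,
    [/\ Nm ^+ (a i - l i) *m x.1 - x.2 = T j,
     Nm ^+ a i *m x.1 = 0 & Nm ^+ b i *m x.2 = 0].
    rewrite /T.
    have [_|] := eqVneq j (inr i).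
      by apply: extend_torsion; [exact: ann_a | constructor 1].
    case: j => j ne; apply: extend_torsion; rewrite ?ann_a ?ann_b //.
      have [->|nij] := eqVneq j i; first by constructor 1.
      by apply: sep nij _; left.
    have nij : j != i by apply: contraNneq ne => ->.
    by apply: sep nij _; right.
  exists (\sum_j (x j).1, \sum_j (x j).2) => /=; split; last first.
  - by rewrite mulmx_sumr big1 // => j _; case: (xP j).
  - by rewrite mulmx_sumr big1 // => j _; case: (xP j).
  rewrite mulmx_sumr -sumrB al_w mulmxN opprK fP f_w mulmxBr hp.
  rewrite (eq_bigr T) => [|j _]; last by case: (xP j).
  rewrite /T.
  rewrite (bigD1 (inr i)) //= [in RHS](bigD1 (inr i)) //= eqxx.
  have -> : (b i - l i = 0)%N by move: (bl i); lia.
  rewrite expr0 mul1mx pcom [RHS]addrC addrA subrK; congr (_ + _).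
  by apply: eq_bigr => j nj; rewrite (negbTE nj).
have [[i|i]|be beN be_e] := gens_lift ge (N' := Nm)
    (y := fun j => match j with inl i => (x i).1 | inr i => (x i).2 end).
- by case: (xP i).
- by case: (xP i).
have beX m (v : 'cV[K]_dm) : be *m (Nm ^+ m *m v) = Nm ^+ m *m (be *m v).
  by rewrite !mulmxA (intertwineX _ beN).
exists be, al; split => //.
have gal : (be *m f + f *m al) *m Nl = Nm *m (be *m f + f *m al).
  by rewrite mulmxDl mulmxDr -!mulmxA fN alN !mulmxA fN beN.
apply: (gens_eqmx gw hN gal) => i; rewrite mulmxDl -!mulmxA f_w mulmxBr beX !be_e.
by case: (xP i) => -> _ _; rewrite subrK.
Qed.

End Injection.

(** For exactness in the middle: modulo the image of [f], each [e (inr i)] equals x^(a i - l i)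
    [e (inl i)], so x becomes a combination of the [e (inl i)] with coefficients [q i]. If g x = 0,
    then x^(c i) divides [q i], and x^(c i) [e (inl i)] is [f] applied to x^(b i) [w i]. *)
Lemma exact_pair : exists (f : 'M[K]_(dm, dl)) (g : 'M[K]_(dc, dm)),
  [/\ f *m Nl = Nm *m f /\ g *m Nm = Nc *m g, right_exact f g,
      full_tangent Nl Nm f & full_tangent Nm Nc g].
Proof.
have [i|f fN f_w] := gens_lift gw (N' := Nm)
    (y := fun i => Nm ^+ (a i - l i) *m e (inl i) - e (inr i)).
  rewrite mulmxBr exprD_mulmx subnKC // ann_a sub0r.
  by rewrite (nilp_ge (bl i) (ann_b i)) oppr0.
have [[i|i]|g gN g_e] := gens_lift ge (N' := Nc)
    (y := fun j => match j with inl i => u i | inr i => Nc ^+ (c i - b i) *m u i end).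
- exact: nilp_ge (ca i) (ann_u i).
- by rewrite exprD_mulmx subnKC.
have g_a i := g_e (inl i); have g_b i := g_e (inr i); rewrite /= in g_a g_b.
have gX m (v : 'cV[K]_dm) : g *m (Nm ^+ m *m v) = Nc ^+ m *m (g *m v).
  by rewrite !mulmxA (intertwineX _ gN).
have gP p (v : 'cV[K]_dm) : g *m (pact Nm p *m v) = pact Nc p *m (g *m v).
  by rewrite !mulmxA (pact_intertwine _ gN).
have fX m (v : 'cV[K]_dl) : f *m (Nl ^+ m *m v) = Nm ^+ m *m (f *m v).
  by rewrite !mulmxA (intertwineX _ fN).
have fP p (v : 'cV[K]_dl) : f *m (pact Nl p *m v) = pact Nm p *m (f *m v).
  by rewrite !mulmxA (pact_intertwine _ fN).
have gf : g *m f = 0.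
  have gfN : (g *m f) *m Nl = Nc *m (g *m f) by rewrite -mulmxA fN !mulmxA gN.
  apply: (gens_eqmx gw gfN); first by rewrite mul0mx mulmx0.
  move=> i; rewrite -mulmxA f_w mulmxBr gX g_a g_b mul0mx.
  by rewrite (_ : a i - l i = c i - b i)%N ?subrr //; move: (ablc i) (la i) (bc i); lia.
exists f, g; split => //; last 2 first.
- exact: injection_tangent.
- exact: surjection_tangent.
split=> [y|x].
  have [p ->] := gens_span gu y; exists (\sum_i pact Nm (p i) *m e (inl i)).
  by rewrite mulmx_sumr; apply: eq_bigr => i _; rewrite gP g_a.
split=> [gx0|[v ->]]; last by rewrite mulmxA gf mul0mx.
have [p ex] := gens_span ge x; rewrite big_sumType /= in ex.
pose q i := p (inl i) + p (inr i) * 'X^(a i - l i).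
have ex' : x = \sum_i pact Nm (q i) *m e (inl i) - f *m (\sum_i pact Nl (p (inr i)) *m w i).
  rewrite ex mulmx_sumr -sumrB -big_split /=; apply: eq_bigr => i _.
  rewrite fP f_w mulmxBr /q pactD mulmxDl pact_mulXn pact_commX -mulmxA opprB.
  by rewrite addrACA subrr addr0 addrC.
have gq : \sum_i pact Nc (q i) *m u i = 0.
  move: gx0; rewrite ex' mulmxBr [g *m (f *m _)]mulmxA gf mul0mx subr0 mulmx_sumr => gx0.
  rewrite -[RHS]gx0.
  by apply: eq_bigr => i _; rewrite gP g_a.
(* [P] projects onto the summand of [u i], so each term of the relation vanishes separately. *)
have qu i : pact Nc (q i) *m u i = 0.
  have [j|P PN Pu] := gens_lift gu (N' := Nc) (y := fun j => if j == i then u i else 0).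
    by case: eqP => [->|_]; rewrite ?mulmx0.
  have := congr1 (mulmx P) gq; rewrite mulmx0 mulmx_sumr (bigD1 i) //= big1 ?addr0 => [P0|j nj].
    by move: P0; rewrite mulmxA (pact_intertwine _ PN) -mulmxA Pu eqxx.
  by rewrite mulmxA (pact_intertwine _ PN) -mulmxA Pu (negbTE nj) mulmx0.
exists (\sum_i pact Nl (drop_poly (c i) (q i)) *m (Nl ^+ b i *m w i)
        - \sum_i pact Nl (p (inr i)) *m w i).
rewrite mulmxBr {1}ex'; congr (_ - _); rewrite mulmx_sumr; apply: eq_bigr => i _.
have -> : q i = drop_poly (c i) (q i) * 'X^(c i).
  rewrite -[LHS](poly_take_drop (c i)) (_ : take_poly _ _ = 0) ?add0r //.
  apply/polyP => j; rewrite coef_take_poly coef0; case: ltnP => // lt.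
  exact: gens_free gu _ _ (qu i) _ lt.
rewrite pact_mulXn fP fX f_w mulmxBr ann_b subr0 exprD_mulmx.
have -> : (b i + (a i - l i) = c i)%N by move: (ablc i) (la i); lia.
by rewrite drop_polyMXn_id pact_commX -mulmxA.
Qed.

End Core.

(** * Openness of orbits *)

Section FunctionAlgebra.
Variable K : fieldType.

(** Abstracts polynomial dependence on a parameter, so that [open_orbit] applies both along a line
    and on a whole space of representations. *)
Record fun_alg (T : Type) (R : (T -> K) -> Prop) : Prop := FunAlg {
  fa_ext : forall f g, f =1 g -> R f -> R g;
  fa_cst : forall c, R (fun=> c);
  fa_add : forall f g, R f -> R g -> R (fun t => f t + g t);
  fa_mul : forall f g, R f -> R g -> R (fun t => f t * g t) }.

Variables (T : Type) (R : (T -> K) -> Prop).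
Hypothesis RA : fun_alg R.

Definition mxfun m n (F : T -> 'M[K]_(m, n)) : Prop :=
  forall i j, R (fun t => F t i j).

Lemma fa_sum (J : Type) (r : seq J) (P : pred J) (F : J -> T -> K) :
  (forall j, R (F j)) -> R (fun t => \sum_(j <- r | P j) F j t).
Proof.
move=> RF; elim: r => [|j r IH].
  by apply: (fa_ext RA) (fa_cst RA 0) => t; rewrite big_nil.
have [Pj|Pj] := boolP (P j).
  by apply: (fa_ext RA) (fa_add RA (RF j) IH) => t; rewrite big_cons Pj.
by apply: (fa_ext RA) IH => t; rewrite big_cons (negbTE Pj).
Qed.

Lemma fa_prod (J : Type) (r : seq J) (F : J -> T -> K) :
  (forall j, R (F j)) -> R (fun t => \prod_(j <- r) F j t).
Proof.
move=> RF; elim: r => [|j r IH].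
  by apply: (fa_ext RA) (fa_cst RA 1) => t; rewrite big_nil.
by apply: (fa_ext RA) (fa_mul RA (RF j) IH) => t; rewrite big_cons.
Qed.

Lemma mxfun_cst m n (M : 'M[K]_(m, n)) : mxfun (fun=> M).
Proof. by move=> i j; apply: fa_cst. Qed.

Lemma mxfun_add m n (F G : T -> 'M[K]_(m, n)) :
  mxfun F -> mxfun G -> mxfun (fun t => F t + G t).
Proof.
by move=> RF RG i j; apply: (fa_ext RA) (fa_add RA (RF i j) (RG i j)) => t; rewrite mxE.
Qed.

Lemma mxfun_scale m n (f : T -> K) (F : T -> 'M[K]_(m, n)) :
  R f -> mxfun F -> mxfun (fun t => f t *: F t).
Proof.
by move=> Rf RF i j; apply: (fa_ext RA) (fa_mul RA Rf (RF i j)) => t; rewrite mxE.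
Qed.

Lemma mxfun_opp m n (F : T -> 'M[K]_(m, n)) : mxfun F -> mxfun (fun t => - F t).
Proof.
by move=> RF i j; apply: (fa_ext RA) (fa_mul RA (fa_cst RA (-1)) (RF i j)) => t;
   rewrite mxE mulN1r.
Qed.

Lemma mxfun_sum m n (J : finType) (P : pred J) (F : J -> T -> 'M[K]_(m, n)) :
  (forall j, mxfun (F j)) -> mxfun (fun t => \sum_(j | P j) F j t).
Proof.
move=> RF i j.
have := fa_sum (index_enum J) P (F := fun a t => F a t i j).
by move=> /(_ (fun a => RF a i j)) h; apply: (fa_ext RA) h => t; rewrite summxE.
Qed.

Lemma mxfun_mul m n p (F : T -> 'M[K]_(m, n)) (G : T -> 'M[K]_(n, p)) :
  mxfun F -> mxfun G -> mxfun (fun t => F t *m G t).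
Proof.
move=> RF RG i j.
have h : R (fun t => \sum_k F t i k * G t k j).
  by apply: fa_sum => k; apply: (fa_mul RA).
by apply: (fa_ext RA) h => t; rewrite mxE.
Qed.

Lemma fa_det n (F : T -> 'M[K]_n) : mxfun F -> R (fun t => \det (F t)).
Proof.
move=> RF; apply: fa_sum => s; apply: (fa_mul RA); first exact: fa_cst.
by apply: fa_prod => i; exact: RF.
Qed.

Lemma mxfun_adj n (F : T -> 'M[K]_n) : mxfun F -> mxfun (fun t => \adj (F t)).
Proof.
move=> RF i j.
have h : R (fun t => cofactor (F t) j i).
  apply: (fa_mul RA); first exact: fa_cst.
  apply: fa_det => x y; apply: (fa_ext RA) (RF (lift j x) (lift i y)) => t.
  by rewrite !mxE.
by apply: (fa_ext RA) h => t; rewrite mxE.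
Qed.

Lemma mxfun_mxvec m n (F : T -> 'M[K]_(m, n)) : mxfun F -> mxfun (fun t => mxvec (F t)).
Proof.
move=> RF i j; rewrite (ord1 i); case/mxvec_indexP: j => x y.
by apply: (fa_ext RA) (RF x y) => t; rewrite mxvecE.
Qed.

(* Cramer's rule for the linear system alpha (G t) = g beta; it is solvable near [t0] because
   the tangent space at [t0] is full. *)
Lemma open_orbit da db (Na : 'M[K]_da) (Nb : 'M[K]_db) (g : 'M[K]_(db, da))
    (B0 : 'M[K]_da) (G : T -> 'M[K]_(db, da)) (Z : T -> Prop) (t0 : T) :
  g *m Na = Nb *m g -> full_tangent Na Nb g -> mxfun G ->
  (forall t, Z t -> G t *m Na = Nb *m G t) ->
  B0 \in unitmx -> B0 *m Na = Na *m B0 -> G t0 = g *m B0 ->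
  exists (al : T -> 'M[K]_db) (be : T -> 'M[K]_da),
    [/\ mxfun al, mxfun be, al t0 = 1%:M, be t0 = B0 &
     forall t, Z t -> [/\ al t *m Nb = Nb *m al t, be t *m Na = Na *m be t
                        & al t *m G t = g *m be t]].
Proof.
move=> gN tg RG GN uB0 B0N G0.
(* Right multiplication by the automorphism [B0] carries the full tangent space at [g] to the point
   [g *m B0]. *)
have tg0 h : h *m Na = Nb *m h -> exists x : 'M[K]_db * 'M[K]_da,
    [/\ x.1 *m Nb = Nb *m x.1, x.2 *m Na = Na *m x.2 & h = x.1 *m (g *m B0) + g *m x.2].
  have B0N' : invmx B0 *m Na = Na *m invmx B0.
    by rewrite -[LHS](mulmxK uB0) -(mulmxA _ Na) -B0N !mulmxA mulVmx // mul1mx.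
  move=> hN; have [|al [be [alN beN e]]] := tg (h *m invmx B0).
    by rewrite -mulmxA B0N' !mulmxA hN.
  exists (al, be *m B0) => /=; split=> //; first by rewrite -mulmxA B0N !mulmxA beN.
  by rewrite -[LHS](mulmxKV uB0) e mulmxDl !mulmxA.
(* The rows of [Bs] form a basis of the space of homomorphisms, written as vectors. *)
pose Bs := row_base (kermx (lin_mx (mulmxr Na \- mulmx Nb : 'M[K]_(db, da) -> 'M_(db, da)))).
have BsP h : (mxvec h <= Bs)%MS <-> h *m Na = Nb *m h.
  rewrite eq_row_base; split=> [/sub_kermxP|e].
    rewrite mul_vec_lin => /(congr1 vec_mx); rewrite mxvecK linear0 /= => /eqP.
    by rewrite subr_eq0 => /eqP.
  by apply/sub_kermxP; rewrite mul_vec_lin /= e subrr linear0.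
pose hb i := vec_mx (row i Bs) : 'M[K]_(db, da).
have hbN i : hb i *m Na = Nb *m hb i by apply/BsP; rewrite /hb vec_mxK row_sub.
have /fin_all_exists[s sP] i := tg0 _ (hbN i).
pose co (h : 'M[K]_(db, da)) := mxvec h *m pinvmx Bs.
have coK h : h *m Na = Nb *m h -> h = vec_mx (co h *m Bs).
  by move/BsP => sub; rewrite /co mulmxKpV // mxvecK.
pose S i t := (s i).1 *m G t + g *m (s i).2.
(* In this basis [Psi t] is the matrix of the linearized problem with [G t] in place of [g *m B0];
   it is the identity at [t0]. *)
pose Psi t := \matrix_i co (S i t).
have SN t i : Z t -> S i t *m Na = Nb *m S i t.
  move=> Zt; have [s1N s2N _] := sP i.
  by rewrite /S mulmxDl mulmxDr -!mulmxA GN // s2N !mulmxA s1N gN.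
have RS i : mxfun (S i).
  apply: mxfun_add; last exact: mxfun_cst.
  by apply: mxfun_mul; [exact: mxfun_cst | exact: RG].
have RPsi : mxfun Psi.
  move=> i j; have h : mxfun (fun t => co (S i t)).
    by apply: mxfun_mul; [exact: mxfun_mxvec | exact: mxfun_cst].
  by apply: (fa_ext RA) (h 0 j) => t; rewrite [RHS]mxE.
have Psi0 : Psi t0 = 1%:M.
  apply/row_matrixP => i; rewrite rowK /S G0; have [_ _ <-] := sP i.
  by rewrite /co /hb vec_mxK -row_mul mulmxVp ?row_base_free.
pose D t := \det (Psi t).
(* The adjugate replaces the inverse of [Psi t], which keeps [y] in the algebra at the price of the
   factor [D t]. *)
pose y t := co (G t - g *m B0) *m \adj (Psi t).
have Ry : mxfun y.
  apply: mxfun_mul; last exact: mxfun_adj.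
  apply: mxfun_mul; last exact: mxfun_cst.
  by apply: mxfun_mxvec; apply: mxfun_add; [exact: RG | exact: mxfun_cst].
have y0 : y t0 = 0 by rewrite /y G0 subrr /co linear0 !mul0mx.
have yP t : Z t -> \sum_i y t 0 i *: S i t = D t *: (G t - g *m B0).
  move=> Zt; have GN' : (G t - g *m B0) *m Na = Nb *m (G t - g *m B0).
    by rewrite mulmxBl mulmxBr GN // -!mulmxA B0N !mulmxA gN.
  have yPsi : y t *m Psi t = D t *: co (G t - g *m B0).
    by rewrite /y -mulmxA mul_adj_mx mul_mx_scalar.
  rewrite [in RHS](coK _ GN') -linearZ /= scalemxAl -yPsi.
  rewrite (mulmx_sum_row (y t)) mulmx_suml linear_sum; apply: eq_bigr => i _ /=.
  by rewrite -scalemxAl linearZ /= rowK -coK //; apply: SN.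
(* The difference of the two sides of the required equation is [D t *: (G t - g *m B0)] minus the
   sum of [y t 0 i *: S i t], which is zero by [yP]. *)
exists (fun t => D t *: 1%:M - \sum_i y t 0 i *: (s i).1),
       (fun t => D t *: B0 + \sum_i y t 0 i *: (s i).2); split.
- apply: mxfun_add.
    by apply: mxfun_scale; [exact: fa_det | exact: mxfun_cst].
  apply: mxfun_opp; apply: mxfun_sum => i.
  by apply: mxfun_scale; [exact: Ry | exact: mxfun_cst].
- apply: mxfun_add.
    by apply: mxfun_scale; [exact: fa_det | exact: mxfun_cst].
  apply: mxfun_sum => i.
  by apply: mxfun_scale; [exact: Ry | exact: mxfun_cst].
- rewrite /D Psi0 det1 scale1r y0 big1 ?subr0 // => i _.
  by rewrite mxE scale0r.
- rewrite /D Psi0 det1 scale1r y0 big1 ?addr0 // => i _.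
  by rewrite mxE scale0r.
move=> t Zt; split.
- rewrite mulmxBl mulmxBr -scalemxAl mul1mx -scalemxAr mulmx1; congr (_ - _).
  rewrite mulmx_suml mulmx_sumr; apply: eq_bigr => i _.
  by rewrite -scalemxAl -scalemxAr; have [-> _ _] := sP i.
- rewrite mulmxDl mulmxDr -scalemxAl -scalemxAr B0N; congr (_ + _).
  rewrite mulmx_suml mulmx_sumr; apply: eq_bigr => i _.
  by rewrite -scalemxAl -scalemxAr; have [_ -> _] := sP i.
have := yP t Zt; rewrite /S.
under eq_bigr => i _ do rewrite scalerDr scalemxAl scalemxAr.
rewrite big_split /= -mulmx_suml -mulmx_sumr scalerBr => e.
rewrite mulmxBl mulmxDr -!scalemxAl mul1mx -scalemxAr.
by apply/eqP; rewrite subr_eq -addrA [X in _ + X]addrC e addrC subrK.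
Qed.
End FunctionAlgebra.

(** * Reflections at a source *)

Section Casts.
Variable K : fieldType.

(* The identity matrix with possibly unequal dimensions; multiplying by it transports matrices along
   provable equalities of dimensions. *)
Definition cid m n : 'M[K]_(m, n) := \matrix_(i, j) (nat_of_ord i == j)%:R.

Lemma cid_id n : cid n n = 1%:M.
Proof. by apply/matrixP => i j; rewrite !mxE val_eqE. Qed.

Lemma cidK m n : m = n -> cid m n *m cid n m = 1%:M.
Proof. by move=> ->; rewrite cid_id mulmx1. Qed.

Lemma cidM m n p : m = n -> n = p -> cid m n *m cid n p = cid m p.
Proof. by move=> -> ->; rewrite cid_id mulmx1. Qed.

Lemma cid_family (I : Type) (D E : I -> nat) (F : forall i, 'M[K]_(D i, E i)) i j :
  i = j -> cid (D j) (D i) *m F i = F j *m cid (E j) (E i).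
Proof. by move=> ->; rewrite !cid_id mul1mx mulmx1. Qed.

Lemma cid_jordan l l' : l = l' ->
  cid (sumn l') (sumn l) *m jordan_mx K l = jordan_mx K l' *m cid (sumn l') (sumn l).
Proof. by move=> ->; rewrite cid_id mul1mx mulmx1. Qed.

Lemma conform_cid m n m' n' (B : 'M[K]_(m', n')) (M : 'M[K]_(m, n)) :
  m = m' -> n = n' -> conform_mx B M = cid m' m *m M *m cid n n'.
Proof.
by move=> em en; case: _ / em B; case: _ / en => B; rewrite conform_mx_id !cid_id mul1mx mulmx1.
Qed.

Lemma conform_col_cid m m' (B : 'cV[K]_m') (M : 'cV[K]_m) :
  m = m' -> conform_mx B M = cid m' m *m M.
Proof. by move=> em; case: _ / em B => B; rewrite conform_mx_id cid_id mul1mx. Qed.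

End Casts.

Section Star.
Variables (n : nat) (A : finType) (src tgt : A -> 'I_n) (k : 'I_n).
Hypothesis source_k : is_source tgt k.
Variable K : fieldType.

Local Notation rsrc := (rev_src src tgt k).
Local Notation rtgt := (rev_tgt src tgt k).
Local Notation cid := (cid K).

Lemma rev_src_at a : src a == k -> rsrc a = tgt a.
Proof. by rewrite /rev_src => ->. Qed.
Lemma rev_tgt_at a : src a == k -> rtgt a = k.
Proof. by rewrite /rev_tgt => /eqP->; rewrite eqxx. Qed.
Lemma rev_src_away a : src a != k -> rsrc a = src a.
Proof. by rewrite /rev_src (negbTE (source_k a)) orbF => /negbTE->. Qed.
Lemma rev_tgt_away a : src a != k -> rtgt a = tgt a.
Proof. by rewrite /rev_tgt (negbTE (source_k a)) orbF => /negbTE->. Qed.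

(** The pairs of an arrow out of [k] and a coordinate at its target index a basis of the direct sum
    of the target spaces, of dimension [star_dim d]; [star_in] and [star_out] are its inclusions and
    projections. *)
Definition star_pred (d : 'I_n -> nat) : pred {a : A & 'I_(d (tgt a))} :=
  [pred x | src (tag x) == k].
Definition star_dim (d : 'I_n -> nat) : nat := #|@star_pred d|.
Definition star_in (d : 'I_n -> nat) (a : A) : 'M[K]_(star_dim d, d (tgt a)) :=
  \matrix_(r, i) (enum_val r == Tagged (fun a => 'I_(d (tgt a))) i)%:R.
Definition star_out (d : 'I_n -> nat) (a : A) : 'M[K]_(d (tgt a), star_dim d) :=
  (star_in d a)^T.

Lemma star_outK d a : src a == k -> star_out d a *m star_in d a = 1%:M.
Proof.
move=> Sa; apply/matrixP => i j; rewrite !mxE.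
have Sx : Tagged (fun a => 'I_(d (tgt a))) i \in @star_pred d by rewrite inE.
rewrite (bigD1 (enum_rank_in Sx (Tagged (fun a => 'I_(d (tgt a))) i))) //= !mxE.
rewrite enum_rankK_in // eqxx mul1r big1 ?addr0 ?eq_Tagged // => r nr.
rewrite !mxE; case: eqP => [er|]; rewrite ?mul0r //.
by case/eqP: nr; apply: enum_val_inj; rewrite enum_rankK_in.
Qed.

Lemma star_out_neq d a b : a != b -> star_out d a *m star_in d b = 0.
Proof.
move=> nab; apply/matrixP => i j; rewrite !mxE big1 // => r _; rewrite !mxE.
case: eqP => [->|]; rewrite ?mul0r //; case: eqP => [/(congr1 tag) /= e|]; rewrite ?mulr0 //.
by rewrite e eqxx in nab.
Qed.

Lemma star_inK d : \sum_(a | src a == k) star_in d a *m star_out d a = 1%:M.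
Proof.
apply/matrixP => r r'; rewrite summxE mxE.
have: enum_val r \in @star_pred d by exact: enum_valP.
case E : (enum_val r) => [a i]; rewrite inE /= => Sa.
rewrite (bigD1 a) //= [X in _ + X]big1 ?addr0 => [|b /andP[_ nb]]; last first.
  rewrite mxE big1 // => j _; rewrite !mxE E; case: eqP => [/(congr1 tag) /= e|]; rewrite ?mul0r //.
  by rewrite e eqxx in nb.
rewrite mxE (bigD1 i) //= !mxE E eqxx mul1r big1 ?addr0.
  by rewrite -[in RHS](inj_eq enum_val_inj) E eq_sym.
move=> j nj; rewrite !mxE E; case: eqP => [/eqP|]; rewrite ?mul0r // eq_Tagged /= => /eqP e.
by rewrite e eqxx in nj.
Qed.

Lemma star_sum_in d (x : forall a, 'cV[K]_(d (tgt a))) b : src b == k ->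
  star_out d b *m \sum_(a | src a == k) star_in d a *m x a = x b.
Proof.
move=> Sb; rewrite mulmx_sumr (bigD1 b) //= mulmxA star_outK // mul1mx big1 ?addr0 //.
by move=> a /andP[_ nab]; rewrite mulmxA star_out_neq 1?eq_sym // mul0mx.
Qed.

Lemma star_eq d p (M M' : 'M[K]_(star_dim d, p)) :
  (forall a, src a == k -> star_out d a *m M = star_out d a *m M') -> M = M'.
Proof.
move=> eqM; rewrite -[M]mul1mx -[M']mul1mx -star_inK !mulmx_suml; apply: eq_bigr => a Sa.
by rewrite -!mulmxA eqM.
Qed.

Lemma star_eqr d p (M M' : 'M[K]_(p, star_dim d)) :
  (forall a, src a == k -> M *m star_in d a = M' *m star_in d a) -> M = M'.
Proof.
move=> eqM; rewrite -[M]mulmx1 -[M']mulmx1 -star_inK !mulmx_sumr; apply: eq_bigr => a Sa.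
by rewrite !mulmxA eqM.
Qed.

(** The map out of [k] whose cokernel defines the reflection; [costar_map] glues the reversed arrows
    in the same way. The [cid] factors identify the spaces at equal vertices. *)
Definition star_map d (V : repT src tgt K d) : 'M[K]_(star_dim d, d k) :=
  \sum_(a | src a == k) star_in d a *m (V a *m cid (d (src a)) (d k)).

Definition costar_map d e (W : repT rsrc rtgt K e) : 'M[K]_(e k, star_dim d) :=
  \sum_(a | src a == k)
    (cid (e k) (e (rtgt a)) *m W a *m cid (e (rsrc a)) (d (tgt a))) *m star_out d a.

Lemma star_out_map d (V : repT src tgt K d) a : src a == k ->
  star_out d a *m star_map V = V a *m cid (d (src a)) (d k).
Proof.
move=> Sa; rewrite mulmx_sumr (bigD1 a) //= mulmxA star_outK // mul1mx big1 ?addr0 //.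
by move=> b /andP[_ nab]; rewrite mulmxA star_out_neq 1?eq_sym // mul0mx.
Qed.

Lemma costar_map_in d e (W : repT rsrc rtgt K e) a : src a == k ->
  costar_map d W *m star_in d a =
  cid (e k) (e (rtgt a)) *m W a *m cid (e (rsrc a)) (d (tgt a)).
Proof.
move=> Sa; rewrite mulmx_suml (bigD1 a) //= -mulmxA star_outK // mulmx1 big1 ?addr0 //.
by move=> b /andP[_ nab]; rewrite -mulmxA star_out_neq // mulmx0.
Qed.

Lemma refl_mapE d e (W : repT rsrc rtgt K e) (x : forall a, 'cV[K]_(d (tgt a))) :
  (forall i, i != k -> e i = d i) ->
  refl_map W x = costar_map d W *m \sum_(a | src a == k) star_in d a *m x a.
Proof.
move=> ed; rewrite mulmx_sumr; apply: eq_bigr => a Sa.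
have e1 : d (tgt a) = e (rsrc a) by rewrite rev_src_at // ed // source_k.
have e2 : e (rtgt a) = e k by rewrite rev_tgt_at.
by rewrite mulmxA costar_map_in // (conform_col_cid _ _ e2) (conform_col_cid _ _ e1) !mulmxA.
Qed.

(** Families of vectors at the targets are the same as vectors of the direct sum, so the cokernel
    condition becomes exactness for two matrices. *)
Lemma is_reflectionE d e (V : repT src tgt K d) (W : repT rsrc rtgt K e) :
  is_reflection V W <->
  [/\ forall i, i != k -> e i = d i,
      forall a, src a != k -> W a = conform_mx 0 (V a)
    & right_exact (star_map V) (costar_map d W)].
Proof.
have away a : ~~ ((src a == k) || (tgt a == k)) = (src a != k).
  by rewrite (negbTE (source_k a)) orbF.
have bigP (z : 'cV[K]_(star_dim d)) :
    z = \sum_(a | src a == k) star_in d a *m (star_out d a *m z).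
  by under eq_bigr => a _ do rewrite mulmxA; rewrite -mulmx_suml star_inK mul1mx.
have imP (x : forall a, 'cV[K]_(d (tgt a))) (v : 'cV[K]_(d k)) :
    (\sum_(a | src a == k) star_in d a *m x a = star_map V *m v) <->
    (forall a, src a == k -> x a = V a *m conform_mx 0 v).
  split=> [ex a Sa|ex].
    have := congr1 (mulmx (star_out d a)) ex; rewrite star_sum_in // mulmxA star_out_map //.
    by rewrite conform_col_cid ?mulmxA // (eqP Sa).
  apply: star_eq => a Sa; rewrite star_sum_in // mulmxA star_out_map // ex //.
  by rewrite conform_col_cid ?mulmxA // (eqP Sa).
split=> [[ed [eW [sur ker]]]|[ed eW [sur ker]]].
  split=> // [a Sa|]; first by apply: eW; rewrite away.
  split=> [y|z].
    by have [x <-] := sur y; eexists; rewrite refl_mapE.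
  rewrite (bigP z) -refl_mapE // ker.
  by split=> -[v ex]; exists v; have [h1 h2] := imP (fun a => star_out d a *m z) v; auto.
split=> //; split=> [a|]; first by rewrite away; exact: eW.
split=> [y|x].
  have [z <-] := sur y; exists (fun a => star_out d a *m z).
  by rewrite refl_mapE // -bigP.
rewrite refl_mapE // ker.
by split=> -[v ex]; exists v; have [h1 h2] := imP x v; auto.
Qed.

Lemma right_exact0 l m c (F : 'M[K]_(m, l)) (G : 'M[K]_(c, m)) :
  right_exact F G -> G *m F = 0.
Proof.
case=> _ ker; apply/matrixP => i j.
have /colP/(_ i) : G *m (F *m delta_mx j (0 : 'I_1)) = 0 by apply: (proj2 (ker _)); eexists.
by rewrite mulmxA -colE !mxE.
Qed.

(** The universal property of the cokernel: the columns of [S *m G - 1%:M] lie in the kernel of [G],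
    hence in the image of [F], and are killed by [M]. *)
Lemma right_exact_section l m c (F : 'M[K]_(m, l)) (G : 'M[K]_(c, m)) :
  right_exact F G -> exists2 S : 'M[K]_(m, c), G *m S = 1%:M &
    forall p (M : 'M[K]_(p, m)), M *m F = 0 -> M *m S *m G = M.
Proof.
case=> sur ker.
have /fin_all_exists[s sP] i : exists x, G *m x = delta_mx i (0 : 'I_1) by exact: sur.
pose S := \matrix_(i, j) s j i 0; have GS : G *m S = 1%:M.
  apply/matrixP => i j; have /colP/(_ i) := sP j; rewrite !mxE eqxx andbT => <-.
  by apply: eq_bigr => r _; rewrite mxE.
exists S => // p M MF; apply/eqP; rewrite -subr_eq0 -{2}[M]mulmx1 -mulmxA -mulmxBr.
apply/eqP/matrixP => i j; rewrite [RHS]mxE.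
have /ker[v ev] : G *m col j (S *m G - 1%:M) = 0.
  by rewrite colE mulmxA mulmxBr mulmxA GS mul1mx mulmx1 subrr mul0mx.
have := congr1 (mulmx M) ev; rewrite mulmxA MF mul0mx colE mulmxA -colE => /colP/(_ i).
by rewrite [col _ _ _ _]mxE => ->; rewrite mxE.
Qed.

(** The rows of [Q] form a basis of the linear forms vanishing on the image of [F]; a vector killed
    by all of them lies in that image, which is seen after transposing to row spaces. *)
Lemma right_exact_coker l m (F : 'M[K]_(m, l)) :
  exists c (Q : 'M[K]_(c, m)), right_exact F Q.
Proof.
exists _, (row_base (kermx F)).
have := row_base_free (kermx F); have := eq_row_base (kermx F).
move: (row_base _) => Q eqQ fQ.
have QF : Q *m F = 0 by apply/sub_kermxP; rewrite eqQ.
split=> [y|x]; first by exists (pinvmx Q *m y); rewrite mulmxA mulmxVp // mul1mx.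
split=> [Qx|[v ->]]; last by rewrite mulmxA QF mul0mx.
have : (x^T <= F^T)%MS.
  rewrite submxE; apply/eqP.
  apply: trmx_inj; rewrite trmx_mul trmxK trmx0.
  have : ((cokermx F^T)^T <= Q)%MS.
    rewrite eqQ; apply/sub_kermxP; apply: trmx_inj.
    by rewrite trmx_mul trmxK mulmx_coker trmx0.
  by case/submxP => D ->; rewrite -mulmxA Qx mulmx0.
by case/submxP => v /(congr1 trmx); rewrite trmxK trmx_mul trmxK => ->; exists v^T.
Qed.

Lemma right_exact_cid l m c c' (F : 'M[K]_(m, l)) (Q : 'M[K]_(c, m)) : c' = c ->
  right_exact F Q -> right_exact F (cid c' c *m Q).
Proof. by move=> ->; rewrite cid_id mul1mx. Qed.

Lemma reflection_exists d (V : repT src tgt K d) :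
  exists e (W : repT rsrc rtgt K e), is_reflection V W.
Proof.
have [c [Q exQ]] := right_exact_coker (star_map V).
pose e i := if i == k then c else d i.
have ek : e k = c by rewrite /e eqxx.
have ed i : i != k -> e i = d i by rewrite /e => /negbTE->.
pose W : repT rsrc rtgt K e := fun a =>
  if src a == k then cid (e (rtgt a)) c *m Q *m star_in d a *m cid (d (tgt a)) (e (rsrc a))
  else conform_mx 0 (V a).
exists e, W; apply/is_reflectionE; split=> // [a Sa|]; first by rewrite /W (negbTE Sa).
have -> : costar_map d W = cid (e k) c *m Q; last exact: right_exact_cid.
apply: star_eqr => a Sa; rewrite costar_map_in // /W Sa !mulmxA cidM ?rev_tgt_at //.
by rewrite -[LHS]mulmxA cidK ?mulmx1 // rev_src_at // ed // source_k.
Qed.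

(** Functoriality of the cokernel: [Phi] and [Psi] are inverse isomorphisms of the direct sums
    compatible with the maps out of [k], so they induce [th] and [th'], inverse to each other
    because [G] and [G'] have right inverses. *)
Lemma reflection_iso d d' e e' (V : repT src tgt K d) (V' : repT src tgt K d')
    (W : repT rsrc rtgt K e) (W' : repT rsrc rtgt K e') :
  rep_iso V V' -> is_reflection V W -> is_reflection V' W' -> rep_iso W W'.
Proof.
case=> phi [psi [inv com]].
case/is_reflectionE => ed eW exV; case/is_reflectionE => ed' eW' exV'.
pose Phi := \sum_(a | src a == k) star_in d' a *m (phi (tgt a) *m star_out d a).
pose Psi := \sum_(a | src a == k) star_in d a *m (psi (tgt a) *m star_out d' a).
have Phi_out a : src a == k -> star_out d' a *m Phi = phi (tgt a) *m star_out d a.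
  move=> Sa; rewrite mulmx_sumr (bigD1 a) //= mulmxA star_outK // mul1mx big1 ?addr0 //.
  by move=> b /andP[_ nab]; rewrite mulmxA star_out_neq 1?eq_sym // mul0mx.
have Psi_out a : src a == k -> star_out d a *m Psi = psi (tgt a) *m star_out d' a.
  move=> Sa; rewrite mulmx_sumr (bigD1 a) //= mulmxA star_outK // mul1mx big1 ?addr0 //.
  by move=> b /andP[_ nab]; rewrite mulmxA star_out_neq 1?eq_sym // mul0mx.
have Phi_in a : src a == k -> Phi *m star_in d a = star_in d' a *m phi (tgt a).
  move=> Sa; rewrite mulmx_suml (bigD1 a) //= -!mulmxA star_outK // mulmx1 big1 ?addr0 //.
  by move=> b /andP[_ nab]; rewrite -!mulmxA star_out_neq // !mulmx0.
have PhiK : Phi *m Psi = 1%:M.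
  apply: star_eq => a Sa; rewrite mulmxA Phi_out // -mulmxA Psi_out // mulmxA.
  by have [_ ->] := inv (tgt a); rewrite mulmx1 mul1mx.
have PsiK : Psi *m Phi = 1%:M.
  apply: star_eq => a Sa; rewrite mulmxA Psi_out // -mulmxA Phi_out // mulmxA.
  by have [-> _] := inv (tgt a); rewrite mulmx1 mul1mx.
have cphi a : src a == k -> phi (src a) *m cid (d (src a)) (d k) = cid (d' (src a)) (d' k) *m phi k.
  by move=> /eqP Sa; rewrite (cid_family phi (esym Sa)).
have PhiF : Phi *m star_map V = star_map V' *m phi k.
  apply: star_eq => a Sa; rewrite !mulmxA Phi_out // star_out_map //.
  by rewrite -mulmxA star_out_map // mulmxA com -!mulmxA cphi.
have PsiF : Psi *m star_map V' = star_map V *m psi k.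
  rewrite -[star_map V']mulmx1; have [_ <-] := inv k.
  by rewrite !mulmxA -(mulmxA Psi) -PhiF !mulmxA PsiK mul1mx.
have [S GS exS] := right_exact_section exV.
have [S' GS' exS'] := right_exact_section exV'.
set G := costar_map d W in GS exS *; set G' := costar_map d' W' in GS' exS' *.
have GF := right_exact0 exV; have GF' := right_exact0 exV'.
have [th thG] : exists th, th *m G = G' *m Phi.
  by exists (G' *m Phi *m S); apply: exS; rewrite -mulmxA PhiF mulmxA GF' mul0mx.
have [th' thG'] : exists th', th' *m G' = G *m Psi.
  by exists (G *m Psi *m S'); apply: exS'; rewrite -mulmxA PsiF mulmxA GF mul0mx.
have thK : th *m th' = 1%:M.
  by rewrite -[LHS]mulmx1 -GS' !mulmxA -(mulmxA th) thG' mulmxA thG -(mulmxA G') PhiK mulmx1.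
have thK' : th' *m th = 1%:M.
  by rewrite -[LHS]mulmx1 -GS !mulmxA -(mulmxA th') thG mulmxA thG' -(mulmxA G) PsiK mulmx1.
exists (fun i => if i == k then cid (e' i) (e' k) *m th *m cid (e k) (e i)
                 else cid (e' i) (d' i) *m phi i *m cid (d i) (e i)).
exists (fun i => if i == k then cid (e i) (e k) *m th' *m cid (e' k) (e' i)
                 else cid (e i) (d i) *m psi i *m cid (d' i) (e' i)).
split=> [i|a].
  have [->|ne] := eqVneq i k; first by rewrite !cid_id !mul1mx !mulmx1 thK thK'.
  have ei := ed i ne; have ei' := ed' i ne; have [i1 i2] := inv i; split.
    rewrite !mulmxA -(mulmxA _ (cid (d' i) (e' i))) cidK // mulmx1.
    by rewrite -(mulmxA _ (psi i)) i1 mulmx1 cidK.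
  rewrite !mulmxA -(mulmxA _ (cid (d i) (e i))) cidK // mulmx1.
  by rewrite -(mulmxA _ (phi i)) i2 mulmx1 cidK.
case: (boolP (src a == k)) => Sa.
  have et : (rtgt a == k) by rewrite rev_tgt_at.
  have es : rsrc a = tgt a by exact: rev_src_at.
  have ns : (rsrc a == k) = false by rewrite es; apply/negbTE/source_k.
  rewrite et ns.
  have e1 : e (rsrc a) = d (tgt a) by rewrite es ed // source_k.
  have e1' : e' (rsrc a) = d' (tgt a) by rewrite es ed' // source_k.
  have e2 : e' (rtgt a) = e' k by rewrite (eqP et).
  (* Restricting [thG] to the summand of [a] gives the square of the reversed arrow; the rest only
     moves [cid] factors. *)
  have := congr1 (mulmxr (star_in d a)) thG => /=.
  rewrite /G /G' -!mulmxA costar_map_in // Phi_in // (mulmxA (costar_map d' W')) costar_map_in //.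
  move/(congr1 (mulmxr (cid (d (tgt a)) (e (rsrc a))))) => /=.
  move/(congr1 (mulmx (cid (e' (rtgt a)) (e' k)))).
  rewrite -!mulmxA cidK // mulmx1 => ->.
  rewrite (mulmxA _ (cid (e' k) _)) cidK // mul1mx; congr (_ *m _).
  have := cid_family phi es.
  move/(congr1 (mulmxr (cid (d (rsrc a)) (e (rsrc a))))) => /=.
  have c1 : d (tgt a) = d (rsrc a) by rewrite es.
  have c2 : d (rsrc a) = e (rsrc a) by rewrite e1 es.
  have c3 : d' (tgt a) = d' (rsrc a) by rewrite es.
  rewrite -[phi _ *m _ *m _]mulmxA (cidM _ c1 c2) => <-.
  by rewrite !mulmxA (cidM _ e1' c3).
have et := rev_tgt_away Sa; have es := rev_src_away Sa.
rewrite eW // eW' // et es (negbTE Sa) (negbTE (source_k a)).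
have t1 : d (tgt a) = e (tgt a) by rewrite ed // source_k.
have s1 : d (src a) = e (src a) by rewrite ed.
have t1' : d' (tgt a) = e' (tgt a) by rewrite ed' // source_k.
have s1' : d' (src a) = e' (src a) by rewrite ed'.
rewrite (conform_cid _ _ t1 s1) (conform_cid _ _ t1' s1') !mulmxA.
rewrite -(mulmxA _ (cid _ (e (tgt a)))) (cidK _ t1) mulmx1.
rewrite -(mulmxA _ (cid _ (e' (src a)))) (cidK _ s1') mulmx1.
by rewrite -(mulmxA _ (phi (tgt a))) com -!mulmxA.
Qed.

End Star.

(** * Interlacing partitions *)

Section Interlacing.
Local Open Scope nat_scope.

(** Padding zeros never equal a positive p, so both sides agree with the sum up to
    [maxn m (size s)]. *)
Lemma count_nth (s : seq nat) p m : 0 < p -> (forall i, m <= i -> nth 0 s i = 0) ->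
  \sum_(i < m) (nth 0 s i == p) = count_mem p s.
Proof.
move=> p0 s0.
have eqM M M' : M <= M' -> (forall i, M <= i -> nth 0 s i = 0) ->
    \sum_(i < M) (nth 0 s i == p) = \sum_(i < M') (nth 0 s i == p).
  move=> le z; rewrite (big_ord_widen M' (fun i => nat_of_bool (nth 0 s i == p))) //.
  rewrite big_mkcond; apply: eq_bigr => i _; case: ltnP => // leM.
  by rewrite z //; case: p p0.
rewrite (eqM _ _ (leq_maxl m (size s)) s0).
rewrite -(eqM _ _ (leq_maxr m (size s)) (fun i => @nth_default _ 0 s i)).
rewrite -sum1_count [RHS]big_mkcond [RHS](big_nth 0) [RHS]big_mkord.
by apply: eq_bigr => i _ /=; case: eqP.
Qed.

Lemma sum_pairs (F : nat -> nat) m :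
  \sum_(j < m) (F (2 * j) + F (2 * j).+1) = \sum_(i < 2 * m) F i.
Proof.
elim: m => [|m IH]; first by rewrite !big_ord0.
by rewrite big_ord_recr IH mulnS !big_ord_recr /= addnA.
Qed.

(** Each of the first [t] parts of [mu] is a block with [b = l = 0] and [a = c]; afterwards each
    part of [lam] is grouped with the two parts of [mu] around it. Monotonicity of [mu] separates
    the blocks, and [size mu] further blocks suffice since beyond them [mu], hence [lam], is
    zero. *)
Lemma interlaced_blocks t (mu lam : seq nat) : interlaced t mu lam ->
  exists s (a b c l : 'I_s -> nat),
  [/\ [/\ forall i, b i <= l i, forall i, l i <= a i & forall i, a i + b i = l i + c i],
      forall i j r, i != j -> (r = a i) \/ (r = b i) ->
        [\/ a j <= r, r <= b j | a j = c j]
    & forall p, 0 < p ->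
      [/\ \sum_i (l i == p) = count_mem p lam,
          \sum_i (c i == p) = count_mem p (part_diff t mu lam)
        & \sum_i (a i == p) + \sum_i (b i == p) = count_mem p mu]].
Proof.
case=> dec int.
have anti i j : i <= j -> nth 0 mu j <= nth 0 mu i.
  by move=> /subnK <-; elim: (j - i) => // n IH; apply: leq_trans (dec _) IH.
pose a i := if i < t then nth 0 mu i else nth 0 mu (t + 2 * (i - t)).
pose b i := if i < t then 0 else nth 0 mu (t + 2 * (i - t)).+1.
pose l i := if i < t then 0 else nth 0 lam (i - t).
pose c i := a i + b i - l i.
have bl i : b i <= l i.
  by rewrite /b /l; case: ltnP => // _; have /andP[] := int (i - t).
have la i : l i <= a i.
  by rewrite /a /l; case: ltnP => // _; have /andP[] := int (i - t).
exists (t + size mu), a, b, c, l; split.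
- by split=> i //; move: (la i); rewrite /c; lia.
- move=> i j r; rewrite -val_eqE /= => ne er.
  case: (ltnP j t) => jt; first by constructor 3; rewrite /c /b /l jt; lia.
  have aj : a j = nth 0 mu (t + 2 * (j - t)) by rewrite /a ltnNge jt.
  have bj : b j = nth 0 mu (t + 2 * (j - t)).+1 by rewrite /b ltnNge jt.
  case: (ltnP i t) => it.
    case: er => ->; last by constructor 2; rewrite {1}/b it.
    by constructor 1; rewrite aj /a it; apply: anti; lia.
  have ai : a i = nth 0 mu (t + 2 * (i - t)) by rewrite /a ltnNge it.
  have bi : b i = nth 0 mu (t + 2 * (i - t)).+1 by rewrite /b ltnNge it.
  have /andP[ler lre] : b i <= r <= a i.
    by case: er => ->; rewrite leqnn ?andbT (leq_trans (bl i) (la i)).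
  case: (ltnP i j) => ij.
    by constructor 1; apply: leq_trans ler; rewrite aj bi; apply: anti; lia.
  by constructor 2; apply: leq_trans lre _; rewrite ai bj; apply: anti; lia.
move=> p p0; have pn0 : (0 == p) = false by case: p p0.
have lt0 (F : nat -> nat) : \sum_(i < t + size mu) F i =
    \sum_(i < t) F i + \sum_(j < size mu) F (t + j) by rewrite big_split_ord.
have mu0 i : size mu <= i -> nth 0 mu i = 0 by exact: nth_default.
split.
- rewrite (lt0 (fun i => nat_of_bool (l i == p))) big1 => [|i _]; last by rewrite /l ltn_ord pn0.
  rewrite add0n -[RHS](@count_nth _ _ (size mu)) //.
    by apply: eq_bigr => j _; rewrite /l ltnNge leq_addr /= addKn.
  move=> i le; apply/eqP; rewrite -leqn0; have /andP[_] := int i.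
  by rewrite mu0 //; lia.
- rewrite (lt0 (fun i => nat_of_bool (c i == p))) count_cat; congr (_ + _).
    rewrite -(@count_nth _ _ t) // => [|i le]; last first.
      by rewrite nth_default // size_take; case: ltnP; lia.
    by apply: eq_bigr => i _; rewrite nth_take // /c /a /b /l ltn_ord addn0 subn0.
  rewrite count_filter (eq_count (a2 := pred1 p)) => [|x /=]; last by case: eqP => // ->.
  have -> : iota 0 (size mu) = index_iota 0 (size mu) by rewrite /index_iota subn0.
  rewrite count_map -sum1_count [RHS]big_mkcond [RHS]big_mkord /=.
  by apply: eq_bigr => j _; rewrite /c /a /b /l ltnNge leq_addr /= addKn; case: eqP.
rewrite (lt0 (fun i => nat_of_bool (a i == p))) (lt0 (fun i => nat_of_bool (b i == p))).
rewrite [\sum_(i < t) (b i == p)]big1 => [|i _]; last by rewrite /b ltn_ord pn0.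
rewrite add0n -addnA -big_split /= -(@count_nth _ _ (t + 2 * size mu)) //; last first.
  by move=> i le; apply: mu0; lia.
rewrite big_split_ord /= -(sum_pairs (fun i => nat_of_bool (nth 0 mu (t + i) == p))).
congr (_ + _); first by apply: eq_bigr => i _; rewrite /a ltn_ord.
by apply: eq_bigr => j _; rewrite /a /b ltnNge leq_addr /= addKn addnS.
Qed.

End Interlacing.

(** * Passing between representations of a quiver and of its reflection *)

Section Transfer.
Variables (n : nat) (A : finType) (src tgt : A -> 'I_n) (k : 'I_n).
Hypothesis source_k : is_source tgt k.
Variable K : fieldType.

Local Notation rsrc := (rev_src src tgt k).
Local Notation rtgt := (rev_tgt src tgt k).
Local Notation cid := (cid K).
Local Notation star_in := (star_in src tgt k K).
Local Notation star_out := (star_out src tgt k K).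
Local Notation star_dim := (star_dim src tgt k).
Local Notation star_map := (@star_map _ _ src tgt k K _).
Local Notation costar_map := (@costar_map _ _ src tgt k K).

Definition star_nil d (J : forall i, 'M[K]_(d i)) : 'M[K]_(star_dim d) :=
  \sum_(a | src a == k) star_in d a *m J (tgt a) *m star_out d a.

Lemma star_nil_in d (J : forall i, 'M[K]_(d i)) a : src a == k ->
  star_nil J *m star_in d a = star_in d a *m J (tgt a).
Proof.
move=> Sa; rewrite mulmx_suml (bigD1 a) //= -mulmxA star_outK // mulmx1 big1 ?addr0 //.
by move=> b /andP[_ nab]; rewrite -mulmxA star_out_neq // mulmx0.
Qed.

Lemma star_out_nil d (J : forall i, 'M[K]_(d i)) a : src a == k ->
  star_out d a *m star_nil J = J (tgt a) *m star_out d a.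
Proof.
move=> Sa; rewrite mulmx_sumr (bigD1 a) //= !mulmxA star_outK // mul1mx big1 ?addr0 //.
by move=> b /andP[_ nab]; rewrite !mulmxA star_out_neq 1?eq_sym // !mul0mx.
Qed.

(** By [gens_sum] over the arrows out of [k], the Jordan type of the direct sum is the union of the
    types at the targets, which is [adj_part]. *)
Lemma gens_star_nil (nu : 'I_n -> seq nat) (J : finType) (o : J -> nat) :
  (forall p, (0 < p)%N -> \sum_j (o j == p) = count_mem p (adj_part src tgt k nu))%N ->
  exists e, gens (star_nil (fun i => jordan_mx K (nu i))) o e.
Proof.
move=> cnt; pose B := {a : A | src a == k}.
have /fin_all_exists[e He] (b : B) := gens_jordan K (nu (tgt (val b))).
pose d i := sumn (nu i).
pose E (b : B) := star_in d (val b); pose P (b : B) := star_out d (val b).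
have PE b : P b *m E b = 1%:M by apply: star_outK; exact: (valP b).
have PE0 b b' : b != b' -> P b *m E b' = 0 by move=> nb; apply: star_out_neq.
have EP : \sum_b E b *m P b = 1%:M.
  by rewrite -(big_sub (fun a => src a == k) (fun a => star_in d a *m star_out d a)) -star_inK.
pose N := star_nil (fun i => jordan_mx K (nu i)).
have NE b : E b *m jordan_mx K (nu (tgt (val b))) = N *m E b.
  by rewrite star_nil_in //; exact: (valP b).
have PN b : P b *m N = jordan_mx K (nu (tgt (val b))) *m P b.
  by rewrite star_out_nil //; exact: (valP b).
have g := gens_sum PE PE0 EP NE PN He.
have [p p0|e' g'] := gens_count (o' := o) _ g; last by exists e'.
rewrite cnt //.
transitivity (\sum_(b : B) \sum_(i < size (nu (tgt (val b))))
                nat_of_bool (nth 0%N (nu (tgt (val b))) i == p))%N.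
  by rewrite (sig_big_dep _ (fun b => predT)); apply: eq_bigr.
rewrite /adj_part count_sort count_flatten -map_comp sumnE big_map big_filter big_enum_cond /=.
rewrite (big_sub (fun a => src a == k)) /=; apply: eq_bigr => b _.
by rewrite -(@count_nth _ _ (size (nu (tgt (val b))))) // => i; exact: nth_default.
Qed.

Variables (d d' : 'I_n -> nat) (J : forall i, 'M[K]_(d i)) (J' : forall i, 'M[K]_(d' i)).
Hypothesis dd' : forall i, i != k -> d' i = d i.
Hypothesis JJ' : forall i, i != k -> cid (d' i) (d i) *m J i = J' i *m cid (d' i) (d i).

Lemma cid_nil i j : i = j -> j != k -> cid (d' i) (d j) *m J j = J' i *m cid (d' i) (d j).
Proof. by move=> ->; exact: JJ'. Qed.

Lemma cid_nil' i j : i = j -> j != k -> cid (d j) (d' i) *m J' i = J j *m cid (d j) (d' i).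
Proof.
move=> -> nj; rewrite -[LHS]mulmx1 -(cidK K (dd' nj)) !mulmxA -(mulmxA _ (J' j)) -JJ' //.
by rewrite !mulmxA cidK ?mul1mx // dd'.
Qed.

Lemma star_map_compat (V : repT src tgt K d) :
  compatible J V -> star_map V *m J k = star_nil J *m star_map V.
Proof.
move=> cV; apply: star_eq => a Sa.
rewrite !mulmxA star_out_map // star_out_nil // -[RHS]mulmxA star_out_map //.
by rewrite -mulmxA (cid_family J (esym (eqP Sa))) !mulmxA cV.
Qed.

Lemma costar_map_compat (W : repT rsrc rtgt K d') :
  compatible J' W -> costar_map d W *m star_nil J = J' k *m costar_map d W.
Proof.
move=> cW; apply: star_eqr => a Sa.
rewrite -[LHS]mulmxA star_nil_in // mulmxA costar_map_in // -[RHS]mulmxA costar_map_in //.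
rewrite -mulmxA (cid_nil (rev_src_at tgt Sa) (source_k a)).
rewrite !mulmxA -(mulmxA _ (W a)) -cW !mulmxA.
by rewrite (cid_family J' (rev_tgt_at tgt Sa)).
Qed.

(** Undoes a reflection: the map out of [k] is prescribed as [f] and all other arrows come from [W].
    In the other direction [reflect_with] prescribes the map [g] into [k]. *)
Definition unreflect (f : 'M[K]_(star_dim d, d k)) (W : repT rsrc rtgt K d') : repT src tgt K d :=
  fun a => if src a == k then star_out d a *m f *m cid (d k) (d (src a))
           else cid (d (tgt a)) (d' (rtgt a)) *m W a *m cid (d' (rsrc a)) (d (src a)).

Definition reflect_with (g : 'M[K]_(d' k, star_dim d)) (V : repT src tgt K d)
  : repT rsrc rtgt K d' :=
  fun a => if src a == k
           then cid (d' (rtgt a)) (d' k) *m g *m star_in d a *m cid (d (tgt a)) (d' (rsrc a))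
           else cid (d' (rtgt a)) (d (tgt a)) *m V a *m cid (d (src a)) (d' (rsrc a)).

Lemma star_map_unreflect f W : star_map (unreflect f W) = f.
Proof.
apply: star_eq => a Sa; rewrite star_out_map // /unreflect Sa -mulmxA cidK ?mulmx1 //.
by rewrite (eqP Sa).
Qed.

Lemma costar_map_reflect_with g V : costar_map d (reflect_with g V) = g.
Proof.
apply: star_eqr => a Sa; rewrite costar_map_in // /reflect_with Sa !mulmxA.
have e1 : d' (rtgt a) = d' k by rewrite rev_tgt_at.
have e2 : d (tgt a) = d' (rsrc a) by rewrite rev_src_at // dd' // source_k.
by rewrite (cidK _ (esym e1)) mul1mx -mulmxA (cidK _ e2) mulmx1.
Qed.

Lemma unreflectK g V a : unreflect (star_map V) (reflect_with g V) a = V a.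
Proof.
rewrite /unreflect /reflect_with; case: ifP => Sa.
  by rewrite star_out_map // -mulmxA cidK ?mulmx1 // (eqP Sa).
have e1 : d (tgt a) = d' (rtgt a) by rewrite rev_tgt_away ?Sa // dd' // source_k.
have e2 : d (src a) = d' (rsrc a) by rewrite rev_src_away ?Sa // dd' // Sa.
by rewrite Sa !mulmxA (cidK _ e1) mul1mx -mulmxA (cidK _ e2) mulmx1.
Qed.

Lemma unreflect_compat f W : f *m J k = star_nil J *m f -> compatible J' W ->
  compatible J (unreflect f W).
Proof.
move=> fJ cW a; rewrite /unreflect; case: ifP => Sa.
  rewrite !mulmxA -star_out_nil // -(mulmxA _ _ f) -fJ -!mulmxA.
  by rewrite (cid_family J (eqP Sa)).
have {}Sa : src a != k by rewrite Sa.
have h1 := cid_nil' (rev_tgt_away source_k Sa) (source_k a).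
have h2 := cid_nil (rev_src_away source_k Sa) Sa.
by rewrite !mulmxA -h1 -(mulmxA _ (J' _)) cW -!mulmxA h2.
Qed.

Lemma reflect_with_compat g V : g *m star_nil J = J' k *m g -> compatible J V ->
  compatible J' (reflect_with g V).
Proof.
move=> gJ cV a; rewrite /reflect_with; case: ifP => Sa.
  have c1 := cid_family J' (esym (rev_tgt_at tgt Sa)).
  have c2 := cid_nil' (rev_src_at tgt Sa) (source_k a).
  rewrite !mulmxA -c1 -(mulmxA _ (J' k)) -gJ -!mulmxA c2.
  by rewrite (mulmxA (star_nil J)) star_nil_in // -!mulmxA.
have {}Sa : src a != k by rewrite Sa.
have h1 := cid_nil (rev_tgt_away source_k Sa) (source_k a).
have h2 := cid_nil' (rev_src_away source_k Sa) Sa.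
by rewrite !mulmxA -h1 -(mulmxA _ (J _)) cV -!mulmxA h2.
Qed.

Lemma unreflect_reflection f W : right_exact f (costar_map d W) ->
  is_reflection (unreflect f W) W.
Proof.
move=> ex; apply/is_reflectionE => //; split=> // [a Sa|]; last by rewrite star_map_unreflect.
have e1 : d (tgt a) = d' (rtgt a) by rewrite rev_tgt_away // dd' // source_k.
have e2 : d (src a) = d' (rsrc a) by rewrite rev_src_away // dd'.
rewrite (conform_cid _ _ e1 e2) /unreflect (negbTE Sa) !mulmxA (cidK _ (esym e1)) mul1mx.
by rewrite -mulmxA (cidK _ (esym e2)) mulmx1.
Qed.

End Transfer.

(** * Generic representations *)

Section PolynomialFunctions.
Variables (n : nat) (A : finType) (src tgt : A -> 'I_n) (d : 'I_n -> nat).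

(** The closure of [polyfun] under pointwise equality, as [fun_alg] demands. *)
Definition polyf (K : fieldType) (h : repT src tgt K d -> K) : Prop :=
  exists2 p, polyfun p & h =1 p.

Lemma polyf_alg (K : fieldType) : fun_alg (@polyf K).
Proof.
split=> [f g fg [p pp fp]|c|f g [p pp fp] [q pq gq]|f g [p pp fp] [q pq gq]].
- by exists p => // X; rewrite -fg.
- by exists (fun=> c) => //; constructor.
- by exists (fun X => p X + q X) => [|X]; [constructor | rewrite fp gq].
- by exists (fun X => p X * q X) => [|X]; [constructor | rewrite fp gq].
Qed.

(** Representations are functions on arrows; a polynomial sees only their values, so agreement arrow
    by arrow is enough. *)
Lemma polyfun_ext (K : fieldType) (p : repT src tgt K d -> K) X Y :
  polyfun p -> (forall a, X a = Y a) -> p X = p Y.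
Proof.
move=> pp eqXY; elim: pp => //= [a i j|f g _ -> _ ->|f g _ -> _ ->] //.
by rewrite eqXY.
Qed.

Lemma polyfun_comp (K : fieldType) (T : Type) (R : (T -> K) -> Prop)
    (p : repT src tgt K d -> K) (F : T -> repT src tgt K d) :
  fun_alg R -> (forall a, mxfun R (fun t => F t a)) -> polyfun p -> R (fun t => p (F t)).
Proof.
move=> RA RF; elim=> [c|a i j|f g _ Rf _ Rg|f g _ Rf _ Rg].
- exact: fa_cst.
- exact: RF.
- exact: fa_add.
- exact: fa_mul.
Qed.

Definition upoly (K : fieldType) (h : K -> K) : Prop :=
  exists q : {poly K}, forall s, h s = q.[s].

Lemma upoly_alg (K : fieldType) : fun_alg (@upoly K).
Proof.
split=> [f g fg [p fp]|c|f g [p fp] [q gq]|f g [p fp] [q gq]].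
- by exists p => s; rewrite -fg.
- by exists c%:P => s; rewrite hornerC.
- by exists (p + q) => s; rewrite hornerD fp gq.
- by exists (p * q) => s; rewrite hornerM fp gq.
Qed.

(** The product of two nonzero polynomials is nonzero, hence has a nonroot over an algebraically
    closed field. *)
Lemma upoly_nonzero (K : closedFieldType) (f g : K -> K) x y :
  upoly f -> upoly g -> f x != 0 -> g y != 0 -> exists s, f s != 0 /\ g s != 0.
Proof.
move=> [p fp] [q gq] fx gy.
have nz (r : {poly K}) z : r.[z] != 0 -> r != 0 by apply: contraNneq => ->; rewrite horner0.
have : p * q != 0 by rewrite mulf_neq0 //; [apply: (nz _ x) | apply: (nz _ y)]; rewrite -?fp -?gq.
case/closed_nonrootP => s; rewrite rootE hornerM mulf_eq0 negb_or => /andP[].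
by rewrite -fp -gq; exists s.
Qed.

Definition line (K : fieldType) (X Y : repT src tgt K d) (s : K) : repT src tgt K d :=
  fun a => X a + s *: (Y a - X a).

Lemma line_upoly (K : fieldType) (X Y : repT src tgt K d) a :
  mxfun (@upoly K) (fun s => line X Y s a).
Proof.
move=> i j; exists ((X a i j)%:P + (Y a i j - X a i j) *: 'X) => s.
by rewrite !mxE hornerD hornerC hornerZ hornerX mulrC.
Qed.

Lemma line_compatible (K : fieldType) (N : forall i, 'M[K]_(d i)) X Y s :
  compatible N X -> compatible N Y -> compatible N (@line K X Y s).
Proof.
by move=> cX cY a; rewrite /line mulmxDr mulmxDl -scalemxAr -scalemxAl mulmxBr mulmxBl cX cY.
Qed.

Lemma line0 (K : fieldType) (X Y : repT src tgt K d) a : line X Y 0 a = X a.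
Proof. by rewrite /line scale0r addr0. Qed.

Lemma line1 (K : fieldType) (X Y : repT src tgt K d) a : line X Y 1 a = Y a.
Proof. by rewrite /line scale1r addrC subrK. Qed.

Lemma line_nonzero (K : closedFieldType) (X Y : repT src tgt K d) p g :
  polyfun p -> upoly g -> p Y != 0 -> g 0 != 0 -> exists s, p (line X Y s) != 0 /\ g s != 0.
Proof.
move=> pp ug pY g0.
apply: (upoly_nonzero (x := 1) (y := 0) _ ug _ g0).
  exact: polyfun_comp (upoly_alg K) (line_upoly X Y) pp.
by rewrite (polyfun_ext pp (line1 X Y)).
Qed.

Lemma not_vanish (K : fieldType) (S : (repT src tgt K d -> K) -> Prop) X :
  ~ vanish S X -> exists2 p, S p & p X != 0.
Proof.
move=> nv; apply: NNPP => ne; apply: nv => p Sp; apply/eqP; apply: contra_notT ne => pX.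
by exists p.
Qed.

(* A linear subspace over an infinite field is irreducible. *)
Lemma principal_open_dense (K : closedFieldType) (N : forall i, 'M[K]_(d i))
    (h : repT src tgt K d -> K) X0 :
  polyfun h -> compatible N X0 -> h X0 != 0 ->
  let U X := compatible N X /\ h X != 0 in
  rel_open (compatible N) U /\ dense_in (compatible N) U.
Proof.
move=> ph cX0 hX0 U; split.
  exists (eq h); split=> [f <- //|X]; rewrite /U; split=> -[cX nz]; split=> //.
    by move=> v; move: nz; rewrite (v h erefl) eqxx.
  by apply/eqP => hX; apply: nz => f <-.
split=> [X [] //|O [S [Sp OP]] [X1 /OP[cX1 /not_vanish[p Sp1 pX1]]]].
have uh : upoly (fun s => h (line X0 X1 s)).
  exact: polyfun_comp (upoly_alg K) (line_upoly X0 X1) ph.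
have h0 : h (line X0 X1 0) != 0 by rewrite (polyfun_ext ph (line0 X0 X1)).
have [s [ps hs]] := line_nonzero X0 (Sp p Sp1) uh pX1 h0.
have cs := line_compatible s cX0 cX1.
exists (line X0 X1 s); split=> //; apply/OP; split=> // v.
by move: ps; rewrite (v p Sp1) eqxx.
Qed.

End PolynomialFunctions.

Lemma right_exact_conj (K : fieldType) l m c (F F1 : 'M[K]_(m, l)) (G G1 : 'M[K]_(c, m))
    (al : 'M[K]_c) (be : 'M[K]_m) (ga : 'M[K]_l) :
  right_exact F1 G1 -> al \in unitmx -> be \in unitmx -> ga \in unitmx ->
  al *m G = G1 *m be -> be *m F = F1 *m ga -> right_exact F G.
Proof.
case=> sur ker ua ub ug aG bF; split=> [y|x].
  have [x ex] := sur (al *m y); exists (invmx be *m x).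
  by rewrite -[LHS](mulKmx ua) (mulmxA al G) aG -(mulmxA G1) (mulKVmx ub) ex mulKmx.
split=> [Gx|[v ->]].
  have /ker[v ev] : G1 *m (be *m x) = 0 by rewrite mulmxA -aG -mulmxA Gx mulmx0.
  exists (invmx ga *m v); rewrite -[LHS](mulKmx ub) ev -[RHS](mulKmx ub) !mulmxA.
  by rewrite -(mulmxA _ be) bF -!mulmxA mulKVmx.
rewrite -[LHS](mulKmx ua) (mulmxA al G) aG -!mulmxA (mulmxA be) bF -mulmxA.
by rewrite (proj2 (ker _)) ?mulmx0 //; eexists.
Qed.

(** * Reflecting a generic representation *)

Section Generic.
Variables (K : closedFieldType) (n : nat) (A : finType) (src tgt : A -> 'I_n) (k : 'I_n).
Hypothesis source_k : is_source tgt k.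
Variables (nu : 'I_n -> seq nat) (t : nat).
Hypothesis inter : interlaced t (adj_part src tgt k nu) (nu k).

Local Notation rsrc := (rev_src src tgt k).
Local Notation rtgt := (rev_tgt src tgt k).
Let nu' := sigma_part src tgt k t nu.
Let d i := sumn (nu i).
Let d' i := sumn (nu' i).
Let J i := jordan_mx K (nu i).
Let J' i := jordan_mx K (nu' i).
Let N := star_nil src tgt k J.

Let nu'E i : i != k -> nu' i = nu i.
Proof. by rewrite /nu' /sigma_part => /negbTE->. Qed.
Let dd' i : i != k -> d' i = d i.
Proof. by move=> ne; rewrite /d' nu'E. Qed.
Let JJ' i : i != k -> cid K (d' i) (d i) *m J i = J' i *m cid K (d' i) (d i).
Proof. by move=> ne; apply: cid_jordan; rewrite nu'E. Qed.

Lemma generic_exact_pair :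
  exists (f : 'M[K]_(star_dim src tgt k d, d k)) (g : 'M[K]_(d' k, star_dim src tgt k d)),
  [/\ f *m J k = N *m f /\ g *m N = J' k *m g, right_exact f g,
      full_tangent (J k) N f & full_tangent N (J' k) g].
Proof.
have [s [a [b [c [l [[bl la ablc] sep cnt]]]]]] := interlaced_blocks inter.
have jg (lam : seq nat) (o : 'I_s -> nat) :
    (forall p, (0 < p)%N -> \sum_i (o i == p) = count_mem p lam)%N ->
    exists e, gens (jordan_mx K lam) o e.
  move=> co; have [e ge] := gens_jordan K lam.
  apply: gens_count ge => p p0; rewrite co //.
  by apply: count_nth => // i; exact: nth_default.
have [w gw] : exists w, gens (J k) l w by apply: jg => p /cnt[].
have [u gu] : exists u, gens (J' k) c u.
  by apply: jg => p /cnt[_ -> _]; rewrite /nu' /sigma_part eqxx.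
have [e ge] : exists e, gens N (fun x => match x with inl i => a i | inr i => b i end) e.
  by apply: gens_star_nil => p /cnt[_ _ <-]; rewrite big_sumType.
exact (exact_pair bl la ablc sep gw ge gu).
Qed.

(** The open set is where h(Y) = det(al Y) det(be Y) P(unreflect (f Y) Y) is nonzero: there Y is the
    reflection of a representation with P nonzero, which is isomorphic to [V]. It is nonempty
    because it contains [Y0]. *)
Lemma generic_reflection (dv : 'I_n -> nat) (V : repT src tgt K dv)
    (e : 'I_n -> nat) (W : repT rsrc rtgt K e) :
  is_GenRep nu V -> is_reflection V W -> is_GenRep nu' W.
Proof.
move=> [U [[S [Sp UP]] [[UZ Ud] Uiso]]] refW.
(* Density is applied to the whole space, open as the locus where the constant 1 is nonzero and
   nonempty because it contains 0. *)
have [X0 [_ UX0]] : exists X, compatible J X /\ U X.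
  apply: Ud; last by exists (fun a => 0) => a; rewrite mulmx0 mul0mx.
  exists (eq (fun=> 1)); split=> [f <-|X]; first by constructor.
  split=> [cX|[]] //; split=> // /(_ _ erefl)/eqP; apply/negP; exact: oner_neq0.
have [cX0 /not_vanish[P SP PX0]] := (proj1 (UP X0)) UX0.
have pP := Sp P SP.
have Piso X : compatible J X -> P X != 0 -> rep_iso X V.
  move=> cX PX; apply: Uiso; apply/UP; split=> // v.
  by move: PX; rewrite (v P SP) eqxx.
have [f1 [g1 [[f1N g1N] ex1 tf1 tg1]]] := generic_exact_pair.
(* On the line from f1 to X0, general points lie both in {P <> 0} and in the orbit of f1. *)
pose Xf : repT src tgt K d := unreflect f1 (reflect_with (d' := d') 0 X0).
have cXf : compatible J Xf.
  apply: (unreflect_compat source_k dd' JJ' f1N).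
  by apply: (reflect_with_compat source_k dd' JJ') => //; rewrite mul0mx mulmx0.
have Rm : mxfun (@upoly K) (fun s => star_map k (line Xf X0 s)).
  apply: mxfun_sum => [|a]; first exact: upoly_alg.
  apply: mxfun_mul; [exact: upoly_alg| |]; first exact: (mxfun_cst (upoly_alg K)).
  by apply: mxfun_mul; [exact: upoly_alg|exact: line_upoly|exact: (mxfun_cst (upoly_alg K))].
have [] := open_orbit (upoly_alg K) (B0 := 1%:M) (Z := fun=> True) (t0 := 0) f1N tf1 Rm.
- by move=> s _; apply: star_map_compat; apply: line_compatible.
- exact: unitmx1.
- by rewrite mul1mx mulmx1.
- rewrite mulmx1 -[RHS](star_map_unreflect f1 (reflect_with (d' := d') 0 X0)).
  by apply: eq_bigr => a _; rewrite line0.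
move=> al [be [Ral Rbe al0 be0 alP]].
have ug : upoly (fun s => \det (al s) * \det (be s)).
  by apply: (fa_mul (upoly_alg K)); apply: (fa_det (upoly_alg K)).
have [s [Ps ns]] : exists s, P (line Xf X0 s) != 0 /\ \det (al s) * \det (be s) != 0.
  by apply: (line_nonzero Xf pP ug PX0); rewrite al0 be0 !det1 mulr1 oner_neq0.
have [] := alP s I; move: ns; rewrite mulf_eq0 negb_or => /andP[].
pose X1 := line Xf X0 s; rewrite -/X1 in Ps *.
have cX1 : compatible J X1 by exact: line_compatible.
move: (al s) (be s) => B0 A0 nB nA B0N A0N B0f {al be Ral Rbe al0 be0 alP ug}.
have uB : B0 \in unitmx by rewrite unitmxE unitfE.
(* Since [B0] carries the map of [X1] out of [k] to [f1 *m A0] with [A0] invertible, [g0] is a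
   cokernel of that map and [Y0] is a reflection of [X1]. *)
pose g0 := g1 *m B0; pose Y0 : repT rsrc rtgt K d' := reflect_with g0 X1.
have g0N : g0 *m N = J' k *m g0 by rewrite /g0 -mulmxA B0N !mulmxA g1N.
have cY0 : compatible J' Y0 by apply: (reflect_with_compat source_k dd' JJ').
have RA := @polyf_alg n A rsrc rtgt d' K.
have RG : mxfun (@polyf _ _ rsrc rtgt d' K)
    (fun Y : repT rsrc rtgt K d' => costar_map d Y).
  apply: (mxfun_sum RA) => a; apply: (mxfun_mul RA); last exact: (mxfun_cst RA).
  apply: (mxfun_mul RA); last exact: (mxfun_cst RA).
  apply: (mxfun_mul RA); first exact: (mxfun_cst RA).
  by move=> i j; eexists => //; exact: pf_coord.
have [] := open_orbit RA (B0 := B0) (Z := compatible J') (t0 := Y0) g1N tg1 RG.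
- by move=> Y cY; apply: costar_map_compat.
- exact: uB.
- exact: B0N.
- exact: costar_map_reflect_with.
move=> al [be [Ral Rbe al0 be0 alP]].
(* Solves [be Y *m f Y = f1 *m A0] up to a scalar, with the adjugate to remain polynomial; the
   constant is chosen so that at [Y0] the map of [X1] is recovered. *)
pose f Y := (\det B0)^-1 *: (\adj (be Y) *m (f1 *m A0)).
have Rf : mxfun (@polyf _ _ rsrc rtgt d' K) f.
  apply: (mxfun_scale RA); first exact: fa_cst.
  by apply: (mxfun_mul RA); [exact: (mxfun_adj RA) | exact: (mxfun_cst RA)].
have f0 : f Y0 = star_map k X1.
  by rewrite /f be0 -B0f mulmxA mul_adj_mx mul_scalar_mx scalerA mulVf ?scale1r.
have Rh : polyf (fun Y => \det (al Y) * \det (be Y) * P (unreflect (f Y) Y)).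
  apply: (fa_mul RA).
    by apply: (fa_mul RA); apply: (fa_det RA).
  apply: (polyfun_comp RA _ pP) => a; rewrite /unreflect; case: (src a == k).
    apply: (mxfun_mul RA); last exact: (mxfun_cst RA).
    by apply: (mxfun_mul RA); first exact: (mxfun_cst RA).
  apply: (mxfun_mul RA); last exact: (mxfun_cst RA).
  apply: (mxfun_mul RA); first exact: (mxfun_cst RA).
  by move=> i j; eexists => //; exact: pf_coord.
case: Rh => h ph hE.
have hY0 : h Y0 != 0.
  rewrite -hE al0 be0 det1 mul1r mulf_neq0 // f0.
  by rewrite (polyfun_ext pP (unreflectK source_k dd' g0 X1)).
have [Uo Ud'] := principal_open_dense ph cY0 hY0.
exists (fun Y => compatible J' Y /\ h Y != 0); split=> //; split=> // Y [cY].
rewrite -hE !mulf_eq0 !negb_or -andbA => /and3P[nal nbe PY].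
have [alN beN alG] := alP Y cY.
have ual : al Y \in unitmx by rewrite unitmxE unitfE.
have ube : be Y \in unitmx by rewrite unitmxE unitfE.
(* The scalar left over by the adjugate is absorbed into the automorphism at [k]. *)
pose A1 := ((\det B0)^-1 * \det (be Y)) *: A0.
have uA : A1 \in unitmx.
  by rewrite unitmxZ ?unitmxE unitfE // mulf_neq0 // invr_eq0.
have A1N : A1 *m J k = J k *m A1 by rewrite -scalemxAl A0N scalemxAr.
have fE : be Y *m f Y = f1 *m A1.
  by rewrite /f -scalemxAr mulmxA mul_mx_adj mul_scalar_mx scalerA -scalemxAr.
have fN : f Y *m J k = N *m f Y.
  rewrite -[LHS](mulKmx ube) -[RHS](mulKmx ube); congr (_ *m _).
  by rewrite !mulmxA fE beN -!mulmxA fE A1N !mulmxA f1N.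
have ex := right_exact_conj ex1 ual ube uA alG fE.
have refY := unreflect_reflection source_k dd' ex.
(* [Y] and [W] are reflections of [unreflect (f Y) Y] and [V], which are isomorphic because P does
   not vanish at the former. *)
apply: reflection_iso refY refW => //.
by apply: Piso => //; apply: (unreflect_compat source_k dd' JJ').
Qed.

End Generic.

Theorem theorem3p5 (K : closedFieldType) (n : nat) (A : finType)
    (src tgt : A -> 'I_n) (k : 'I_n) (nu : 'I_n -> seq nat) (t : nat)
    (dv : 'I_n -> nat) (V : repT src tgt K dv) :
  is_dynkin_quiver src tgt ->
  is_source tgt k ->
  (forall i, is_part (nu i)) ->
  interlaced t (adj_part src tgt k nu) (nu k) ->
  is_GenRep nu V ->
  (exists (e : 'I_n -> nat) (W : repT (rev_src src tgt k) (rev_tgt src tgt k) K e),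
      is_reflection V W) /\
  (forall (e : 'I_n -> nat) (W : repT (rev_src src tgt k) (rev_tgt src tgt k) K e),
      is_reflection V W ->
      is_GenRep (sigma_part src tgt k t nu) W).
Proof.
move=> _ source_k _ inter genV; split; first exact: reflection_exists.
by move=> e W; apply: generic_reflection.
Qed.
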